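(* Let $G$ be a finite group generated by pseudoreflections on $\mathbb{C}^n$. If $\Omega$ is a $G$-invariant domain in $\mathbb{C}^n$, then $\mathcal{O}(\Omega)$ is a finitely generated free module over $\mathcal{O}(\Omega)^G$ of rank $|G|$.
   Context: A pseudoreflection on $\mathbb{C}^n$ is a linear map $\rho:\mathbb{C}^n\to\mathbb{C}^n$ of finite order in $GL(n,\mathbb{C})$ such that $I_n-\rho$ has rank $1$. A domain (connected open set) $\Omega$ is $G$-invariant if $\rho(\Omega)=\Omega$ for all $\rho\in G$. $\mathcal{O}(\Omega)$ is the ring of holomorphic functions $\Omega\to\mathbb{C}$, and $\mathcal{O}(\Omega)^G$ is the subring of functions $f$ with $f(\rho^{-1}\boldsymbol z)=f(\boldsymbol z)$ for all $\rho\in G$, $\boldsymbol z\in\Omega$. *)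

(* Defs.v *)
From HB Require Import structures.
From mathcomp Require Import all_boot all_order all_algebra.
From mathcomp Require Export finmap.
From mathcomp Require Import complex.
From mathcomp Require Import mathcomp_extra boolp classical_sets functions.
From mathcomp Require Import cardinality reals topology normedtype derive.

Set Implicit Arguments.
Unset Strict Implicit.
Unset Printing Implicit Defensive.

Import Order.TTheory GRing.Theory Num.Theory.
Import numFieldNormedType.Exports.

Local Open Scope classical_set_scope.
Local Open Scope ring_scope.

Section LinearGroups.
Context {K : fieldType} {n : nat}.
Implicit Types (rho : 'M[K]_n) (H S : set 'M[K]_n).

(* A matrix [rho] stands for the linear map [z |-> rho *m z] on columns. *)
Definition pseudoreflection rho : Prop :=
  [/\ rho \in unitmx, exists2 k, (0 < k)%N & rho ^+ k = 1
    & \rank (1%:M - rho) = 1%N].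

Definition linear_group H : Prop :=
  [/\ forall rho, H rho -> rho \in unitmx,
      H 1%:M,
      forall rho sigma, H rho -> H sigma -> H (rho *m sigma)
    & forall rho, H rho -> H (invmx rho)].

Definition generated_by_pseudoreflections H : Prop :=
  exists2 S, S `<=` pseudoreflection & H = smallest linear_group S.

Definition invariant_set H (Omega : set 'cV[K]_n) : Prop :=
  forall rho, H rho -> [set rho *m z | z in Omega] = Omega.

End LinearGroups.

(* The ring O(Omega); it is the ring of holomorphic functions when [K] is the
   field of complex numbers, as differentiability is with respect to [K]. *)
Section Holomorphic.
Context {K : numFieldType} {n : nat}.
Implicit Type Omega : set 'cV[K]_n.

Definition domain Omega : Prop := open Omega /\ connected Omega.

(* Holomorphy of [f : Omega -> K] is complex differentiability at every point
   of [Omega]. Since [differentiable] is about functions defined on the whole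
   space, [f] is extended to such a function [g]; as [Omega] is open, the values
   of [g] outside [Omega] do not matter. *)
Definition holomorphic Omega (f : Omega -> K) : Prop :=
  exists2 g : 'cV[K]_n -> K,
    (forall z, Omega z -> differentiable g z) & f = sigL Omega g.

Definition holo_pred Omega : {pred Omega -> K} :=
  fun f => `[< holomorphic f >].

Fact holo_subring_closed Omega : subring_closed (@holo_pred Omega).
Proof.
split=> [|f f'|f f'].
- by apply/asboolP; exists (cst 1) => // z _; exact: differentiable_cst.
- move=> /asboolP[g dg ->] /asboolP[g' dg' ->]; apply/asboolP.
  by exists (g - g') => // z Oz; apply: differentiableB; [exact: dg|exact: dg'].
- move=> /asboolP[g dg ->] /asboolP[g' dg' ->]; apply/asboolP.
  by exists (g * g') => // z Oz; apply: differentiableM; [exact: dg|exact: dg'].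
Qed.

HB.instance Definition _ Omega :=
  GRing.isSubringClosed.Build (Omega -> K) (@holo_pred Omega)
    (@holo_subring_closed Omega).

Record holo Omega := Holo {
  holo_val :> Omega -> K;
  holo_valP : holo_val \in @holo_pred Omega }.

HB.instance Definition _ Omega := [isSub for @holo_val Omega].
HB.instance Definition _ Omega := [Choice of holo Omega by <:].
HB.instance Definition _ Omega :=
  GRing.SubChoice_isSubComPzRing.Build (Omega -> K) (@holo_pred Omega)
    (holo Omega) (@holo_subring_closed Omega).

(* [w] ranges over the points of [Omega] equal to [rho^-1 z]; there is exactly
   one for all [rho] and [z] when [Omega] is [G]-invariant. *)
Definition invariant_holo (G : set 'M[K]_n) Omega (f : holo Omega) : Prop :=
  forall rho, G rho -> forall z w : Omega,
    set_val w = invmx rho *m set_val z -> f w = f z.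

Definition invariant_pred (G : set 'M[K]_n) Omega : {pred holo Omega} :=
  fun f => `[< invariant_holo G f >].

Fact invariant_subring_closed G Omega : subring_closed (@invariant_pred G Omega).
Proof.
split=> [|f f'|f f'].
- by apply/asboolP.
- move=> /asboolP inv_f /asboolP inv_f'; apply/asboolP => rho Grho z w wE.
  by congr (_ - _); [exact: inv_f wE|exact: inv_f' wE].
- move=> /asboolP inv_f /asboolP inv_f'; apply/asboolP => rho Grho z w wE.
  by congr (_ * _); [exact: inv_f wE|exact: inv_f' wE].
Qed.

HB.instance Definition _ G Omega :=
  GRing.isSubringClosed.Build (holo Omega) (@invariant_pred G Omega)
    (@invariant_subring_closed G Omega).

Record inv_holo (G : set 'M[K]_n) Omega := InvHolo {
  inv_holo_val :> holo Omega;
  inv_holo_valP : inv_holo_val \in @invariant_pred G Omega }.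

HB.instance Definition _ G Omega := [isSub for @inv_holo_val G Omega].
HB.instance Definition _ G Omega := [Choice of inv_holo G Omega by <:].
HB.instance Definition _ G Omega :=
  GRing.SubChoice_isSubComPzRing.Build (holo Omega) (@invariant_pred G Omega)
    (inv_holo G Omega) (@invariant_subring_closed G Omega).

(* O(Omega) as a module over its subring O(Omega)^G. *)
Definition holo_module (G : set 'M[K]_n) Omega : Type := holo Omega.

HB.instance Definition _ G Omega := GRing.ComPzRing.on (holo_module G Omega).

Definition holo_scale G Omega (a : inv_holo G Omega) (f : holo_module G Omega) :
  holo_module G Omega := (inv_holo_val a : holo_module G Omega) * f.

Fact holo_scaleA G Omega (a b : inv_holo G Omega) f :
  holo_scale a (holo_scale b f) = holo_scale (a * b) f.
Proof. exact: mulrA. Qed.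

Fact holo_scale1 G Omega : left_id 1 (@holo_scale G Omega).
Proof. by move=> f; exact: mul1r. Qed.

Fact holo_scaleDr G Omega : right_distributive (@holo_scale G Omega) +%R.
Proof. by move=> a f g; exact: mulrDr. Qed.

Fact holo_scaleDl G Omega f : {morph (@holo_scale G Omega)^~ f : a b / a + b}.
Proof. by move=> a b; exact: mulrDl. Qed.

HB.instance Definition _ G Omega :=
  GRing.Zmodule_isLmodule.Build (inv_holo G Omega) (holo_module G Omega)
    (@holo_scaleA G Omega) (@holo_scale1 G Omega) (@holo_scaleDr G Omega)
    (@holo_scaleDl G Omega).

End Holomorphic.

Section FreeModules.
Context (A : pzRingType) (M : lmodType A).

Definition module_basis m (e : 'I_m -> M) : Prop :=
  (forall v, exists a : 'I_m -> A, v = \sum_(i < m) a i *: e i) /\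
  (forall a : 'I_m -> A,
     \sum_(i < m) a i *: e i = 0 -> forall i, a i = 0).

Definition finite_free_of_rank (m : nat) : Prop :=
  exists e : 'I_m -> M, module_basis e.

End FreeModules.

(* Main.v *)
From HB Require Import structures.
Require Import Defs.
From mathcomp Require Import all_boot all_order all_algebra finmap.
From mathcomp Require Import complex.
From mathcomp Require Import mathcomp_extra boolp classical_sets functions.
From mathcomp Require Import cardinality reals constructive_ereal topology.
From mathcomp Require Import normedtype landau derive ereal sequences realfun.
From mathcomp Require Import measure lebesgue_measure lebesgue_integral ftc.
From mathcomp Require Import trigo ring lra.

Set Implicit Arguments.
Unset Strict Implicit.
Unset Printing Implicit Defensive.

Import Order.TTheory GRing.Theory Num.Theory.
Import numFieldNormedType.Exports.
Import ComplexField.Normc.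

Local Open Scope classical_set_scope.
Local Open Scope complex_scope.
Local Open Scope ring_scope.

(** This is the analytic form of the theorem of Chevalley on the polynomial
    invariants of a finite group generated by pseudoreflections.  The proof
    constructs homogeneous polynomials [p_i] that form a basis, together with
    the coordinate functionals.

    Let [s] be a pseudoreflection with mirror [l = 0].  The function
    [f - f o s] vanishes on the mirror, so the divided difference
    [(f - f o s) / l] is a polynomial if [f] is one, and is holomorphic on
    [Omega] if [f] is.  Composing such operators, and multiplying by
    polynomials, gives operators [T] that act on both kinds of functions
    ([admissible]).  At a point [z] with trivial stabiliser (a regular point),
    [T f z] is a linear function of the values of [f] on the orbit of [z];
    hence [T] commutes with the multiplication by invariant functions, and an
    identity between operators that holds on polynomials holds on all
    functions, since polynomials interpolate on an orbit
    ([orbit_interpolation]).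

    On polynomials, let [J] be the ideal generated by the invariant forms of
    positive degree ([hilbert_ideal]).  If all the divided differences of a
    form [x] of positive degree lie in [J], then so does [x - x o s] for each
    pseudoreflection [s], hence [x - x o rho] for each [rho] in [G]; as the
    average of [x] over [G] is in [J], so is [x].  By induction on the degree,
    each form outside [J] is sent to the constant [1] by some operator that
    lowers the degree by that of the form ([coinvariant_separation]).  A
    Gram-Schmidt procedure, by increasing degree, then produces forms [p_i]
    that generate the polynomials over the invariant ones, and operators [T_i]
    with [T_i p_j] equal to the Kronecker symbol ([dual_system_extend]).  It
    terminates because [J] contains all the forms of large degree
    ([hilbert_ideal_large]).

    For [f] holomorphic on [Omega], [f = sum_i (T_i f) p_i] with [T_i f]
    invariant: at a regular point, replace [f] by a polynomial with the same
    values on the orbit; the other points follow by density.  Applying [T_i]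
    to a linear relation between the [p_j] shows that its coefficients vanish.
    Finally, the values of the [p_i] on one regular orbit form an invertible
    matrix, so there are as many [p_i] as elements in [G]
    ([free_over_invariants]).

    The analytic ingredient is the division of a holomorphic function by a
    linear form on whose kernel it vanishes ([holomorphic_division]).
    Holomorphy is differentiability at each point, so this rests on the theorem
    of Goursat, from which follow the Cauchy formula on squares and bounds on
    the second order remainder.  Near a point of the mirror the quotient is a
    Cauchy integral whose integrand depends holomorphically on the point, and
    these bounds allow to differentiate under the integral sign. *)

(** * Bisection of rectangles *)

(** Otherwise the property fails on one of the quarters, and so on: it fails on
    nested rectangles that shrink to a point, around which it should hold. *)
Lemma rectangle_bisection (R : realType) (P : R -> R -> R -> R -> Prop)
    (a0 b0 c0 d0 : R) :
    (forall a b c d, a <= b -> c <= d ->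
      P a ((a + b) / 2) c ((c + d) / 2) -> P ((a + b) / 2) b c ((c + d) / 2) ->
      P a ((a + b) / 2) ((c + d) / 2) d -> P ((a + b) / 2) b ((c + d) / 2) d ->
      P a b c d) ->
    (forall x y, a0 <= x <= b0 -> c0 <= y <= d0 ->
      exists2 e, 0 < e & forall a b c d,
        a0 <= a <= x -> x <= b <= b0 -> c0 <= c <= y -> y <= d <= d0 ->
        b - a < e -> d - c < e -> P a b c d) ->
  a0 <= b0 -> c0 <= d0 -> P a0 b0 c0 d0.
Proof.
move=> P4 Ploc ab cd; apply: contrapT => nP.
pose T := (R * R * (R * R))%type.
pose ok (q : T) := [/\ q.1.1 <= q.1.2, q.2.1 <= q.2.2 &
  ~ P q.1.1 q.1.2 q.2.1 q.2.2].
pose half (q q' : T) := [/\ ok q', q.1.1 <= q'.1.1, q'.1.2 <= q.1.2 &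
  [/\ q.2.1 <= q'.2.1, q'.2.2 <= q.2.2,
  q'.1.2 - q'.1.1 = (q.1.2 - q.1.1) / 2 & q'.2.2 - q'.2.1 = (q.2.2 - q.2.1) / 2]].
have step (q : T) : exists q', ok q -> half q q'.
  have [okq|nokq] := pselect (ok q); last by exists q.
  suff [q' hq'] : exists q', half q q' by exists q'.
  apply: contrapT => nq'; case: okq; case: q nq' => -[a b] [c d] /= nq' ab' cd'.
  apply; apply: P4 => //; apply: contrapT => nP'; apply: nq'.
  - exists ((a, (a + b) / 2), (c, (c + d) / 2)).
    by split=> /=; [split=> //=; lra|lra|lra|split; lra].
  - exists (((a + b) / 2, b), (c, (c + d) / 2)).
    by split=> /=; [split=> //=; lra|lra|lra|split; lra].
  - exists ((a, (a + b) / 2), ((c + d) / 2, d)).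
    by split=> /=; [split=> //=; lra|lra|lra|split; lra].
  - exists (((a + b) / 2, b), ((c + d) / 2, d)).
    by split=> /=; [split=> //=; lra|lra|lra|split; lra].
(* [f] selects a quarter on which [P] still fails *)
have [f fP] := choice step.
pose q k := iter k f ((a0, b0), (c0, d0)).
have okq k : ok (q k).
  by elim: k => [|k IH]; [split|have [] := fP _ IH].
have hq k : half (q k) (q k.+1) by exact: fP.
have le1 k m : (k <= m)%N ->
    [/\ (q k).1.1 <= (q m).1.1, (q m).1.2 <= (q k).1.2,
        (q k).2.1 <= (q m).2.1 & (q m).2.2 <= (q k).2.2].
  elim: m => [|m IH]; first by rewrite leqn0 => /eqP->.
  rewrite leq_eqVlt => /predU1P[->//|/IH[h1 h2 h3 h4]].
  by have [_ g1 g2 [g3 g4 _ _]] := hq m; split; lra.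
have wid k : (q k).1.2 - (q k).1.1 = (b0 - a0) / 2 ^+ k /\
             (q k).2.2 - (q k).2.1 = (d0 - c0) / 2 ^+ k.
  elim: k => [|k [IH1 IH2]]; first by rewrite expr0 !divr1.
  have [_ _ _ [_ _ -> ->]] := hq k.
  by rewrite IH1 IH2 exprS invfM; split; lra.
have lr k m : (q k).1.1 <= (q m).1.2 /\ (q k).2.1 <= (q m).2.2.
  have [h1 _ h3 _] := le1 _ _ (leq_maxl k m).
  have [_ h2 _ h4] := le1 _ _ (leq_maxr k m).
  by have [g1 g2 _] := okq (maxn k m); split; lra.
pose x := sup (range (fun k => (q k).1.1)).
pose y := sup (range (fun k => (q k).2.1)).
have xl k : (q k).1.1 <= x.
  apply: ub_le_sup; last by exists k.
  by exists b0 => _ [m _ <-]; have [] := lr m 0%N.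
have yl k : (q k).2.1 <= y.
  apply: ub_le_sup; last by exists k.
  by exists d0 => _ [m _ <-]; have [] := lr m 0%N.
have xr k : x <= (q k).1.2.
  apply: ge_sup; first by exists (q 0%N).1.1, 0%N.
  by move=> _ [m _ <-]; have [] := lr m k.
have yr k : y <= (q k).2.2.
  apply: ge_sup; first by exists (q 0%N).2.1, 0%N.
  by move=> _ [m _ <-]; have [] := lr m k.
have [||e e0 He] := Ploc x y.
- by rewrite (xl 0%N) (xr 0%N).
- by rewrite (yl 0%N) (yr 0%N).
have [k Hk] : exists k, (b0 - a0) / 2 ^+ k < e /\ (d0 - c0) / 2 ^+ k < e.
  pose M := (b0 - a0) + (d0 - c0) + 1.
  have M0 : 0 < M by rewrite /M; lra.
  exists (Num.bound (M / e)).
  have lt : M / e < 2 ^+ Num.bound (M / e).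
    apply: lt_trans (archi_boundP _) _; first by apply: divr_ge0; lra.
    by rewrite -natrX ltr_nat ltn_expl.
  have p0 : 0 < 2 ^+ Num.bound (M / e) :> R by rewrite exprn_gt0.
  rewrite !ltr_pdivrMr //; move: lt; rewrite ltr_pdivrMr // /M => lt.
  by split; lra.
have [w1 w2] := wid k; have [h1 h2 nPk] := okq k.
have [g1 g2 g3 g4] := le1 _ _ (leq0n k).
apply: nPk; apply: He; rewrite ?w1 ?w2 ?xl ?xr ?yl ?yr ?g1 ?g2 ?g3 ?g4 //.
- by case: Hk.
- by case: Hk.
Qed.

(** * Integrals of complex functions on an interval *)

Section ComplexIntegral.
Context {R : realType}.
Local Notation C := (Num.NumField.sort (complex_complex__canonical__Num_NumField R)).
Local Notation Re := (@complex.Re R).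
Local Notation Im := (@complex.Im R).
Implicit Types (a b : R) (f g : R -> C).

Lemma normcE (z : C) : `|z| = (normc z)%:C.
Proof. by case: z => a b; rewrite normc_def. Qed.

Lemma normc_ge0 (z : C) : 0 <= normc z.
Proof. by case: z => a b; exact: sqrtr_ge0. Qed.

Lemma normcR (x : R) : normc x%:C = `|x|.
Proof. by rewrite /= expr0n /= addr0 sqrtr_sqr. Qed.

Lemma normc_Re (z : C) : `|Re z| <= normc z.
Proof. by rewrite -lecR -normcE; exact: normc_ge_Re. Qed.

Lemma normc_Im (z : C) : `|Im z| <= normc z.
Proof.
have := normc_Re (z * 'i); rewrite ReiNIm normrN normcM.
by rewrite /= expr0n expr1n add0r sqrtr1 mulr1.
Qed.

Lemma normc_le_ReIm (z : C) : normc z <= `|Re z| + `|Im z|.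
Proof.
rewrite [in leLHS](complexE z); apply: le_trans (le_normcD _ _) _.
rewrite normcM !normcR lerD2l [normc 'i]/=.
by rewrite expr0n expr1n add0r sqrtr1 mul1r.
Qed.

Lemma complex_gt0 (e : C) : 0 < e -> e = (Re e)%:C /\ 0 < Re e.
Proof. by case: e => x y; rewrite ltcE /= => /andP[/eqP-> ?]. Qed.

(** The order and the norm of the complex field take complex values; this and
    the next lemma express its topology by real numbers. *)
Lemma cvg_normc (T : Type) (F : set_system T) (FF : Filter F) (f : T -> C) l :
  (forall e : R, 0 < e -> \forall x \near F, normc (f x - l) < e) <->
  f x @[x --> F] --> l.
Proof.
split=> [H|/cvgrPdist_lt H e e0].
- apply/cvgrPdist_lt => e /complex_gt0[-> e0].
  by apply: filterS (H _ e0) => x; rewrite distrC normcE ltcR.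
- have := H e%:C; rewrite ltcR => /(_ e0).
  by apply: filterS => x; rewrite distrC normcE ltcR.
Qed.

Lemma near_normc (z : C) (P : C -> Prop) :
  (\forall w \near z, P w) <->
  exists2 d : R, 0 < d & forall w, normc (w - z) < d -> P w.
Proof.
split=> [H0|[d d0 H]].
  have /(nbhs_ballP z P)[d /= /complex_gt0[dE d0] H] : nbhs z P := H0.
  exists (Re d) => // w wz; apply: H; rewrite dE.
  by rewrite -ball_normE /= distrC normcE ltcR.
suff : nbhs z P by [].
apply/(nbhs_ballP z P); exists d%:C; first by rewrite /= ltcR.
  by move=> w; rewrite -ball_normE /= distrC normcE ltcR => /H.
Qed.

Lemma continuous_Re : continuous (Re : C -> R).
Proof.
move=> z; apply/(cvgrPdist_lt (FF := nbhs_filter z)) => e e0.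
apply/near_normc; exists e => // w wz.
by rewrite distrC -raddfB; apply: le_lt_trans wz; exact: normc_Re.
Qed.

Lemma continuous_Im : continuous (Im : C -> R).
Proof.
move=> z; apply/(cvgrPdist_lt (FF := nbhs_filter z)) => e e0.
apply/near_normc; exists e => // w wz.
by rewrite distrC -raddfB; apply: le_lt_trans wz; exact: normc_Im.
Qed.

(** Continuity is required at each point of the segment as a function on the
    whole line: the integrands below are continuous on open sets. *)
Definition cont_on a b f := forall x, a <= x <= b -> {for x, continuous f}.

Definition rintegral a b (f : R -> R) : R :=
  (\int[@lebesgue_measure R]_(x in `[a, b]) f x)%R.

Definition cintegral a b f : C := rintegral a b (Re \o f) +i* rintegral a b (Im \o f).

Lemma integrable_cont a b (f : R -> R) :
  (forall x, a <= x <= b -> {for x, continuous f}) ->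
  (@lebesgue_measure R).-integrable `[a, b] (EFin \o f).
Proof.
move=> cf; apply: continuous_compact_integrable; first exact: segment_compact.
apply: continuous_in_subspaceT => x; rewrite inE /= in_itv /=; exact: cf.
Qed.

Lemma cont_on_Re a b f : cont_on a b f ->
  forall x, a <= x <= b -> {for x, continuous (Re \o f)}.
Proof.
by move=> cf x /cf cfx; apply: continuous_comp => //; exact: continuous_Re.
Qed.

Lemma cont_on_Im a b f : cont_on a b f ->
  forall x, a <= x <= b -> {for x, continuous (Im \o f)}.
Proof.
by move=> cf x /cf cfx; apply: continuous_comp => //; exact: continuous_Im.
Qed.

Lemma eq_cintegral a b f g : (forall x, a <= x <= b -> f x = g x) ->
  cintegral a b f = cintegral a b g.
Proof.
move=> fg; congr (_ +i* _); apply: eq_Rintegral => x; rewrite inE /= in_itv /=;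
by move=> /fg; rewrite /= => ->.
Qed.

Lemma cintegral_cst a b (k : C) : a <= b -> cintegral a b (fun=> k) = (b - a)%:C * k.
Proof.
move=> ab; rewrite /cintegral /rintegral /=.
rewrite !Rintegral_cst //= !lebesgue_measure_itv /=.
rewrite lte_fin; case: ltgtP ab => //= [lt|->] _.
  by case: k => u v; simpc; rewrite ![_ * (b - a)]mulrC.
by rewrite subrr mul0r !mulr0.
Qed.

Lemma cont_onD a b f g : cont_on a b f -> cont_on a b g ->
  cont_on a b (fun x => f x + g x).
Proof. by move=> cf cg x xab; apply: cvgD; [exact: cf|exact: cg]. Qed.

Lemma cont_onM a b f g : cont_on a b f -> cont_on a b g ->
  cont_on a b (fun x => f x * g x).
Proof. by move=> cf cg x xab; apply: cvgM; [exact: cf|exact: cg]. Qed.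

Lemma cont_on_cst a b (k : C) : cont_on a b (fun=> k).
Proof. by move=> x _; exact: cvg_cst. Qed.

Lemma cont_onN a b f : cont_on a b f -> cont_on a b (fun x => - f x).
Proof. by move=> cf x xab; apply: cvgN; exact: cf. Qed.

Lemma cintegralD a b f g : cont_on a b f -> cont_on a b g ->
  cintegral a b (fun x => f x + g x) = cintegral a b f + cintegral a b g.
Proof.
move=> cf cg; rewrite /cintegral /rintegral; simpc; congr (_ +i* _).
- rewrite -RintegralD //; last 2 first.
  + exact/integrable_cont/cont_on_Re.
  + exact/integrable_cont/cont_on_Re.
  by apply: eq_Rintegral => x _ /=; rewrite raddfD.
- rewrite -RintegralD //; last 2 first.
  + exact/integrable_cont/cont_on_Im.
  + exact/integrable_cont/cont_on_Im.
  by apply: eq_Rintegral => x _ /=; rewrite raddfD.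
Qed.

Lemma cintegralZ a b (k : C) f : cont_on a b f ->
  cintegral a b (fun x => k * f x) = k * cintegral a b f.
Proof.
move=> cf; case: k => u v.
have iR : (@lebesgue_measure R).-integrable `[a, b] (EFin \o (Re \o f)).
  exact/integrable_cont/cont_on_Re.
have iI : (@lebesgue_measure R).-integrable `[a, b] (EFin \o (Im \o f)).
  exact/integrable_cont/cont_on_Im.
have cst (r : R) (h : R -> C) (p : C -> R) : continuous p -> cont_on a b h ->
    (@lebesgue_measure R).-integrable `[a, b] (EFin \o (fun x => r * p (h x))).
  move=> cp ch; apply: integrable_cont => x xab; apply: cvgM.
    exact: cvg_cst.
  by apply: continuous_comp; [exact: ch|exact: cp].
rewrite /cintegral /rintegral; simpc; congr (_ +i* _).
- rewrite -(RintegralZl u _ iR) // -(RintegralZl v _ iI) // -RintegralB //; last 2 first.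
  + by apply: cst => //; exact: continuous_Re.
  + by apply: cst => //; exact: continuous_Im.
  by apply: eq_Rintegral => x _ /=; case: (f x).
- rewrite -(RintegralZl v _ iR) // -(RintegralZl u _ iI) // -RintegralD //; last 2 first.
  + by apply: cst => //; exact: continuous_Im.
  + by apply: cst => //; exact: continuous_Re.
  by apply: eq_Rintegral => x _ /=; case: (f x).
Qed.

Lemma cintegral_split a m b f : a <= m <= b -> cont_on a b f ->
  cintegral a b f = cintegral a m f + cintegral m b f.
Proof.
move=> /andP[am mb] cf.
have chR (p : C -> R) : continuous p ->
    rintegral a b (p \o f) = rintegral a m (p \o f) + rintegral m b (p \o f).
  move=> cp; rewrite /rintegral.
  have ip : (@lebesgue_measure R).-integrable `[a, b] (EFin \o (p \o f)).
    apply: integrable_cont => x xab.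
    by apply: continuous_comp; [exact: cf|exact: cp].
  have := @Rintegral_itvB R (p \o f) (BLeft a) (BRight b) m ip.
  rewrite !bnd_simp => /(_ am mb).
  rewrite Rintegral_itv_obnd_cbnd; first by move=> <-; rewrite addrC subrK.
  apply: integrableS ip => //; apply: subset_itv; rewrite ?bnd_simp //.
rewrite /cintegral; simpc; rewrite !chR //; [exact: continuous_Im|exact: continuous_Re].
Qed.

(** The factor [2] comes from bounding separately the real and the imaginary
    parts. *)
Lemma normc_cintegral a b f (M : R) : a <= b -> cont_on a b f ->
  (forall x, a <= x <= b -> normc (f x) <= M) ->
  normc (cintegral a b f) <= 2 * (M * (b - a)).
Proof.
move=> ab cf fM.
have bR (p : C -> R) : continuous p -> (forall z, `|p z| <= normc z) ->
    `|rintegral a b (p \o f)| <= M * (b - a).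
  move=> cp pn.
  have cpf : forall x, a <= x <= b -> {for x, continuous (p \o f)}.
    by move=> x xab; apply: continuous_comp; [exact: cf|exact: cp].
  apply: le_trans (le_normr_Rintegral _ (integrable_cont cpf)) _ => //.
  have -> : M * (b - a) = rintegral a b (fun=> M).
    rewrite /rintegral Rintegral_cst //= lebesgue_measure_itv /=.
    by rewrite lte_fin; case: ltgtP ab => //= -> _; rewrite subrr.
  apply: le_Rintegral => //.
  - apply: integrable_cont => x xab.
    by apply: (@continuous_comp _ _ _ (p \o f)); [exact: cpf|exact: norm_continuous].
  - by apply: integrable_cont => x _; exact: cvg_cst.
  - move=> x /=; rewrite in_itv /= => /fM; apply: le_trans; exact: pn.
apply: le_trans (normc_le_ReIm _) _; rewrite /cintegral /= mulr2n mulrDl mul1r.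
by apply: lerD; apply: bR;
  [exact: continuous_Re|exact: normc_Re|exact: continuous_Im|exact: normc_Im].
Qed.

End ComplexIntegral.

(** * Integrals along the boundary of a rectangle *)

Lemma differentiable_dist (K : numFieldType) (V W : normedModType K)
    (f : V -> W) x : differentiable f x -> forall e : K, 0 < e ->
  \forall w \near (0 : V), `|f (w + x) - f x - 'd f x w| <= e * `|w|.
Proof.
move=> /diff_locally /eqaddoP H e e0.
by apply: filterS (H e e0) => w /=; rewrite !fctE /= opprD addrA.
Qed.

Lemma dist_differentiable (K : numFieldType) (V W : normedModType K)
    (f : V -> W) x (L : {linear V -> W}) : continuous L ->
  (forall e : K, 0 < e ->
    \forall w \near (0 : V), `|f (w + x) - f x - L w| <= e * `|w|) ->
  differentiable f x.
Proof.
move=> cL H.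
have E : f \o shift x = cst (f x) + L +o_ (0 : V) id.
  apply/eqaddoP => e e0.
  by apply: filterS (H e e0) => w /=; rewrite !fctE /= opprD addrA.
by apply/diff_locallyP; rewrite (diff_unique cL E).
Qed.

Section Rectangles.
Context {R : realType}.
Local Notation C := (Num.NumField.sort (complex_complex__canonical__Num_NumField R)).
Local Notation Re := (@complex.Re R).
Local Notation Im := (@complex.Im R).
Implicit Types (a b c d : R) (f g : C -> C).

Lemma ler_normcD (z w : C) : normc (z + w) <= normc z + normc w.
Proof. exact: le_normcD. Qed.

Lemma normc_distC (z w : C) : normc (z - w) = normc (w - z).
Proof. by rewrite -normcN opprB. Qed.

Lemma continuous_normc f z : {for z, continuous f} ->
  forall e : R, 0 < e -> exists2 d : R, 0 < d &
    forall w, normc (w - z) < d -> normc (f w - f z) < e.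
Proof.
by move=> /(cvg_normc (nbhs_filter z)) H e /H /near_normc.
Qed.

Lemma differentiable_normc f z : differentiable f z ->
  exists A : C, forall e : R, 0 < e -> exists2 d : R, 0 < d &
    forall w, normc (w - z) < d ->
      normc (f w - f z - A * (w - z)) <= e * normc (w - z).
Proof.
move=> df; exists ('d f z 1) => e e0.
have := differentiable_dist df; move=> /(_ e%:C); rewrite ltcR => /(_ e0).
move=> /near_normc[d d0 H]; exists d => // w wz.
have := H (w - z); rewrite subr0 => /(_ wz).
have -> : 'd f z (w - z) = 'd f z 1 * (w - z).
  by rewrite -[X in 'd f z X]mulr1 -[_ * 1]/((w - z) *: (1 : C)) linearZ mulrC.
by rewrite subrK !normcE -[e%:C * _]rmorphM lecR.
Qed.

Lemma hpath_cont a b c f :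
    (forall x, a <= x <= b -> {for (x +i* c : C), continuous f}) ->
  cont_on a b (fun x => f (x +i* c)).
Proof.
move=> cf x xab; apply/(cvg_normc (nbhs_filter x)) => e e0.
have [d d0 H] := continuous_normc (cf x xab) e0.
near=> y; apply: H.
have -> : y +i* c - x +i* c = (y - x)%:C by simpc.
rewrite normcR distrC.
by near: y; apply: cvgr_dist_lt => //; exact: cvg_id.
Unshelve. all: by end_near. Qed.

Lemma vpath_cont a c d f :
    (forall y, c <= y <= d -> {for (a +i* y : C), continuous f}) ->
  cont_on c d (fun y => f (a +i* y)).
Proof.
move=> cf x xab; apply/(cvg_normc (nbhs_filter x)) => e e0.
have [r r0 H] := continuous_normc (cf x xab) e0.
near=> y; apply: H.
have -> : a +i* y - a +i* x = (y - x)%:C * 'i by simpc.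
rewrite normcM normcR [normc 'i]/= expr0n expr1n add0r sqrtr1 mulr1 distrC.
by near: y; apply: cvgr_dist_lt => //; exact: cvg_id.
Unshelve. all: by end_near. Qed.

(** The counterclockwise integral of [f] along the boundary of the rectangle
    [[a, b] x [c, d]], opposite sides being grouped together. *)
Definition rect_integral a b c d f : C :=
  cintegral a b (fun x => f (x +i* c) - f (x +i* d)) +
  'i * cintegral c d (fun y => f (b +i* y) - f (a +i* y)).

Definition boundary_cont a b c d f :=
  [/\ cont_on a b (fun x => f (x +i* c)), cont_on a b (fun x => f (x +i* d)),
      cont_on c d (fun y => f (a +i* y)) & cont_on c d (fun y => f (b +i* y))].

Lemma cont_onB a b (f g : R -> C) : cont_on a b f -> cont_on a b g ->
  cont_on a b (fun x => f x - g x).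
Proof. by move=> cf cg; exact: (cont_onD cf (cont_onN cg)). Qed.

Lemma cintegralB a b (f g : R -> C) : cont_on a b f -> cont_on a b g ->
  cintegral a b (fun x => f x - g x) = cintegral a b f - cintegral a b g.
Proof.
move=> cf cg; rewrite (cintegralD cf (cont_onN cg)); congr (_ + _).
rewrite -mulN1r -(cintegralZ _ cg).
by apply: eq_cintegral => x _; rewrite mulN1r.
Qed.

Lemma rect_integral_comb a b c d (k : C) f g :
  boundary_cont a b c d f -> boundary_cont a b c d g ->
  rect_integral a b c d (fun z => k * f z + g z) =
    k * rect_integral a b c d f + rect_integral a b c d g.
Proof.
move=> [f1 f2 f3 f4] [g1 g2 g3 g4]; rewrite /rect_integral.
have E (p q : R) (u v u' v' : R -> C) :
    cont_on p q u -> cont_on p q v -> cont_on p q u' -> cont_on p q v' ->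
    cintegral p q (fun x => k * u x + u' x - (k * v x + v' x)) =
    k * cintegral p q (fun x => u x - v x) + cintegral p q (fun x => u' x - v' x).
  move=> cu cv cu' cv'; rewrite -(cintegralZ k (cont_onB cu cv)).
  rewrite -(cintegralD (cont_onM (@cont_on_cst _ _ _ k) (cont_onB cu cv))
    (cont_onB cu' cv')).
  by apply: eq_cintegral => x _; ring.
by rewrite (E a b _ _ _ _ f1 f2 g1 g2) (E c d _ _ _ _ f4 f3 g4 g3); ring.
Qed.

Lemma rect_integral_split_re a m b c d f : a <= m <= b -> boundary_cont a b c d f ->
    cont_on c d (fun y => f (m +i* y)) ->
  rect_integral a b c d f = rect_integral a m c d f + rect_integral m b c d f.
Proof.
move=> amb [f1 f2 f3 f4] fm; rewrite /rect_integral (cintegral_split amb (cont_onB f1 f2)).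
rewrite (cintegralB f4 f3) (cintegralB f4 fm) (cintegralB fm f3); ring.
Qed.

Lemma rect_integral_split_im a b c m d f : c <= m <= d -> boundary_cont a b c d f ->
    cont_on a b (fun x => f (x +i* m)) ->
  rect_integral a b c d f = rect_integral a b c m f + rect_integral a b m d f.
Proof.
move=> cmd [f1 f2 f3 f4] fm; rewrite /rect_integral (cintegral_split cmd (cont_onB f4 f3)).
rewrite (cintegralB f1 f2) (cintegralB f1 fm) (cintegralB fm f2); ring.
Qed.

Lemma normc_rect_integral a b c d f (M : R) :
    a <= b -> c <= d -> boundary_cont a b c d f ->
    (forall x, a <= x <= b -> normc (f (x +i* c)) <= M /\ normc (f (x +i* d)) <= M) ->
    (forall y, c <= y <= d -> normc (f (a +i* y)) <= M /\ normc (f (b +i* y)) <= M) ->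
  normc (rect_integral a b c d f) <= 4 * M * ((b - a) + (d - c)).
Proof.
move=> ab cd [f1 f2 f3 f4] h v; apply: le_trans (ler_normcD _ _) _.
rewrite normcM [normc 'i]/= expr0n expr1n add0r sqrtr1 mul1r.
have -> : 4 * M * (b - a + (d - c)) =
  2 * ((2 * M) * (b - a)) + 2 * ((2 * M) * (d - c)) by ring.
have E (u v' : C) : normc u <= M -> normc v' <= M -> normc (u - v') <= 2 * M.
  by move=> uM vM; apply: le_trans (ler_normcD _ _) _; rewrite normcN; lra.
apply: lerD.
- by apply: (normc_cintegral ab (cont_onB f1 f2)) => x /h[]; exact: E.
- by apply: (normc_cintegral cd (cont_onB f4 f3)) => x /v[h1 h2]; exact: E.
Qed.

(** The values of an affine function on opposite sides differ by a constant,
    and the contributions of the two pairs of sides cancel. *)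
Lemma rect_integral_affine a b c d (k m : C) : a <= b -> c <= d ->
  rect_integral a b c d (fun z => k * z + m) = 0.
Proof.
move=> ab cd; rewrite /rect_integral.
rewrite (@eq_cintegral _ a b _ (fun=> k * 'i * (c - d)%:C)); last first.
  move=> x _; rewrite opprD addrACA subrr addr0 -mulrBr -mulrA; congr (_ * _).
  by simpc.
rewrite (@eq_cintegral _ c d _ (fun=> k * (b - a)%:C)); last first.
  move=> x _; rewrite opprD addrACA subrr addr0 -mulrBr; congr (_ * _).
  by simpc.
rewrite !cintegral_cst // !rmorphB /=; ring.
Qed.

End Rectangles.

(** * The theorem of Goursat *)

Lemma affine_continuous (K : numFieldType) (A B w : K) :
  {for w, continuous (fun w => A * w + B)}.
Proof.
apply: (@continuousD _ _ _ (fun w => A * w) (fun=> B)); last exact: cst_continuous.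
apply: (@continuousM _ _ (fun=> A) id); first exact: cst_continuous.
by move=> ?.
Qed.

Lemma continuousB_at (K : numFieldType) (f g : K -> K) (w : K) :
  {for w, continuous f} -> {for w, continuous g} ->
  {for w, continuous (fun w => f w - g w)}.
Proof. exact: continuousB. Qed.

Section Goursat.
Context {R : realType}.
Local Notation C := (Num.NumField.sort (complex_complex__canonical__Num_NumField R)).
Local Notation Re := (@complex.Re R).
Local Notation Im := (@complex.Im R).
Implicit Types (a b c d : R) (f g : C -> C).

Lemma normc_rectangle a b c d x y u v : a <= x <= b -> c <= y <= d ->
  a <= u <= b -> c <= v <= d ->
  normc (u +i* v - (x +i* y) : C) <= (b - a) + (d - c).
Proof.
move=> /andP[? ?] /andP[? ?] /andP[? ?] /andP[? ?].
apply: le_trans (normc_le_ReIm _) _; simpc => /=.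
by apply: lerD; rewrite ler_norml; apply/andP; split; lra.
Qed.

Lemma boundary_cont_at a b c d f :
    (forall x y, a <= x <= b -> c <= y <= d ->
      [\/ x = a, x = b, y = c | y = d] -> {for (x +i* y : C), continuous f}) ->
  a <= b -> c <= d -> boundary_cont a b c d f.
Proof.
move=> cf ab cd; split; [apply: hpath_cont|apply: hpath_cont|
  apply: vpath_cont|apply: vpath_cont] => x xab; apply: cf; rewrite ?lexx ?ab ?cd //.
- exact: Or43.
- exact: Or44.
- exact: Or41.
- exact: Or42.
Qed.


Lemma itv_sub (a b u v x : R) : a <= u -> v <= b -> u <= x <= v -> a <= x <= b.
Proof. by move=> au vb /andP[ux xv]; rewrite (le_trans au) ?(le_trans xv). Qed.

Lemma boundary_cont_sub a b c d u v s t f :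
    (forall x y, a <= x <= b -> c <= y <= d -> {for (x +i* y : C), continuous f}) ->
  a <= u -> u <= v -> v <= b -> c <= s -> s <= t -> t <= d -> boundary_cont u v s t f.
Proof.
move=> cf au uv vb cs st td; apply: (boundary_cont_at _ uv st) => x y xu yv _.
by apply: cf; [exact: itv_sub xu|exact: itv_sub yv].
Qed.

Lemma rect_integral_quarter a m b c p d f : a <= m <= b -> c <= p <= d ->
    (forall x y, a <= x <= b -> c <= y <= d -> {for (x +i* y : C), continuous f}) ->
  rect_integral a b c d f = rect_integral a m c p f + rect_integral a m p d f +
    (rect_integral m b c p f + rect_integral m b p d f).
Proof.
move=> amb cpd cf; have /andP[am mb] := amb; have /andP[cp pd] := cpd.
have bc := boundary_cont_sub cf; have ab := le_trans am mb; have cd := le_trans cp pd.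
have B1 := bc a b c d (lexx _) ab (lexx _) (lexx _) cd (lexx _).
have [_ _ V _] := bc m m c d am (lexx _) mb (lexx _) cd (lexx _).
rewrite (rect_integral_split_re amb B1 V).
have [H _ _ _] := bc a m p p (lexx _) am mb cp (lexx _) pd.
rewrite (rect_integral_split_im cpd (bc _ _ _ _ (lexx _) am mb (lexx _) cd (lexx _)) H).
have [H' _ _ _] := bc m b p p am mb (lexx _) cp (lexx _) pd.
by rewrite (rect_integral_split_im cpd (bc _ _ _ _ am mb (lexx _) (lexx _) cd (lexx _)) H').
Qed.

Lemma midP (a b : R) : a <= b -> a <= (a + b) / 2 <= b.
Proof. by move=> ab; apply/andP; split; lra. Qed.

(** For each [e > 0] the integral is at most [e] times the square of the
    half-perimeter.  This property passes from the quarters to the whole, as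
    each of the four quarters has half the perimeter; and it holds near each
    point, where [f] is affine up to an error that is small compared with the
    distance. *)
Lemma Goursat a b c d f : a <= b -> c <= d ->
    (forall x y, a <= x <= b -> c <= y <= d ->
      differentiable f (x +i* y : C)) ->
  rect_integral a b c d f = 0.
Proof.
move=> ab cd df; apply: eq0_normc; apply/le_anti; rewrite normc_ge0 andbT.
set S := (b - a) + (d - c).
suff H (e : R) : 0 < e -> normc (rect_integral a b c d f) <= e * S ^+ 2.
  apply/ler_addgt0Pr => e e0; rewrite add0r.
  have S0 : 0 < S ^+ 2 + 1 by rewrite ltr_wpDl // sqr_ge0.
  apply: le_trans (H (e / (S ^+ 2 + 1)) _) _; first exact: divr_gt0.
  rewrite mulrAC ler_pdivrMr // ler_wpM2l ?(ltW e0) //; lra.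
move=> e0.
pose P a' b' c' d' := a <= a' -> b' <= b -> c <= c' -> d' <= d ->
  normc (rect_integral a' b' c' d' f) <= e * ((b' - a') + (d' - c')) ^+ 2.
suff : P a b c d by apply.
apply: (@rectangle_bisection R P a b c d) => //.
- move=> a' b' c' d' ab' cd' P1 P2 P3 P4 aa bb cc dd.
  have /andP[m1 m2] := midP ab'; have /andP[p1 p2] := midP cd'.
  have {P1} h1 := P1 aa (le_trans m2 bb) cc (le_trans p2 dd).
  have {P2} h2 := P2 (le_trans aa m1) bb cc (le_trans p2 dd).
  have {P3} h3 := P3 aa (le_trans m2 bb) (le_trans cc p1) dd.
  have {P4} h4 := P4 (le_trans aa m1) bb (le_trans cc p1) dd.
  rewrite (rect_integral_quarter (midP ab') (midP cd')); last first.
    move=> x y xab ycd; apply: differentiable_continuous.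
    by apply: df; [exact: itv_sub xab|exact: itv_sub ycd].
  apply: le_trans (ler_normcD _ _) _.
  apply: le_trans (lerD (ler_normcD _ _) (ler_normcD _ _)) _.
  apply: le_trans (lerD (lerD h1 h3) (lerD h2 h4)) _.
  by rewrite le_eqVlt; apply/orP; left; apply/eqP; field.
move=> x y xab ycd.
have [A /(_ (e / 4))] := differentiable_normc (df x y xab ycd).
case; first by rewrite divr_gt0.
move=> r r0 Hr; exists (r / 2); first by rewrite divr_gt0.
move=> a' b' c' d' /andP[aa ax] /andP[xb bb] /andP[cc cy] /andP[yd dd] rb rd _ _ _ _.
have ab' := le_trans ax xb.
have cd' := le_trans cy yd.
set s := (b' - a') + (d' - c').
have xyin : a' <= x <= b' /\ c' <= y <= d' by split; apply/andP; split.
pose z : C := x +i* y.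
pose g (w : C) := f w - (A * w + (f z - A * z)).
have gE w : g w = f w - f z - A * (w - z) by rewrite /g; ring.
have cf u v : a' <= u <= b' -> c' <= v <= d' ->
    {for (u +i* v : C), continuous f}.
  move=> uab vcd; apply: differentiable_continuous.
  by apply: df; [exact: itv_sub uab|exact: itv_sub vcd].
have ca (w : C) : {for w, continuous (fun w => A * w + (f z - A * z))}.
  exact: affine_continuous.
have cg u v : a' <= u <= b' -> c' <= v <= d' ->
    {for (u +i* v : C), continuous g}.
  by move=> uab vcd; apply: continuousB_at; [exact: cf|exact: ca].
have bg : boundary_cont a' b' c' d' g.
  by apply: (boundary_cont_at _ ab' cd') => u v ? ? _; exact: cg.
have ba : boundary_cont a' b' c' d' (fun w => A * w + (f z - A * z)).
  by apply: (boundary_cont_at _ ab' cd') => u v ? ? _; exact: ca.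
have -> : rect_integral a' b' c' d' f = rect_integral a' b' c' d' g.
  have := rect_integral_comb 1 bg ba; rewrite mul1r rect_integral_affine // addr0 => <-.
  by congr rect_integral; apply/funext => w; rewrite /g mul1r subrK.
have gM u v : a' <= u <= b' -> c' <= v <= d' -> normc (g (u +i* v)) <= e / 4 * s.
  move=> uab vcd; rewrite gE; have [xab' ycd'] := xyin.
  have N := normc_rectangle xab' ycd' uab vcd.
  apply: le_trans (Hr _ _) _; first by apply: le_lt_trans N _; rewrite (splitr r); exact: ltrD.
  by rewrite ler_wpM2l // divr_ge0 // ltW.
apply: le_trans (@normc_rect_integral _ _ _ _ _ _ (e / 4 * s) ab' cd' bg _ _) _.
- by move=> u uab; split; apply: gM; rewrite ?lexx ?ab' ?cd'.
- by move=> u uab; split; apply: gM; rewrite ?lexx ?ab' ?cd'.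
by rewrite le_eqVlt; apply/orP; left; apply/eqP; rewrite -/s; field.
Qed.


End Goursat.

(** * The Cauchy formula *)

Lemma differentiable_inv_sub (K : numFieldType) (t w : K) : w != t ->
  differentiable (fun z => (z - t)^-1) w.
Proof.
move=> wt; apply: (@differentiableV _ _ (fun z => z - t)); last by rewrite subr_eq0.
by apply: (@differentiableB _ _ _ id (cst t)); [exact: ex_diff|exact: differentiable_cst].
Qed.

Lemma differentiable_quotient (K : numFieldType) (f : K -> K) (k t w : K) :
  differentiable f w -> w != t ->
  differentiable (fun z => (f z - k) / (z - t)) w.
Proof.
move=> df wt; apply: (@differentiableM _ _ (fun z => f z - k) (fun z => (z - t)^-1)).
  by apply: (@differentiableB _ _ _ f (cst k)); [|exact: differentiable_cst].
exact: differentiable_inv_sub.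
Qed.

Section Cauchy.
Context {R : realType}.
Local Notation C := (Num.NumField.sort (complex_complex__canonical__Num_NumField R)).
Local Notation Re := (@complex.Re R).
Local Notation Im := (@complex.Im R).
Implicit Types (a b c d : R) (f g : C -> C).

Lemma complex_neq (u v x y : R) : u != x \/ v != y -> (u +i* v : C) != x +i* y.
Proof. by rewrite eq_complex /= negb_and => -[]->//; rewrite orbT. Qed.

(** The part of the rectangle outside a small square around the singular point
    splits into four rectangles, to which the theorem of Goursat applies. *)
Lemma rect_integral_shrink a b c d x y e f : 0 < e ->
    a <= x - e -> x + e <= b -> c <= y - e -> y + e <= d ->
    (forall u v, a <= u <= b -> c <= v <= d -> (u +i* v : C) != x +i* y ->
      differentiable f (u +i* v : C)) ->
  rect_integral a b c d f = rect_integral (x - e) (x + e) (y - e) (y + e) f.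
Proof.
move=> e0 ax xb cy yd df.
have xe : x - e <= x + e by lra.
have ye : y - e <= y + e by lra.
have ltx : x - e < x by lra.
have gtx : x < x + e by lra.
have lty : y - e < y by lra.
have gty : y < y + e by lra.
have ax' := le_trans ax xe; have xb' := le_trans xe xb.
have cy' := le_trans cy ye; have yd' := le_trans ye yd.
have ab := le_trans ax xb'; have cd := le_trans cy yd'.
have bc u v s t : a <= u -> u <= v -> v <= b -> c <= s -> s <= t -> t <= d ->
    [/\ u != x, v != x, s != y & t != y] -> boundary_cont u v s t f.
  move=> au uv vb cs st td [ux vx sy ty].
  apply: (boundary_cont_at _ uv st) => p q pu qs pq.
  apply: differentiable_continuous; apply: df.
  - exact: itv_sub pu.
  - exact: itv_sub qs.
  - by apply: complex_neq; case: pq => ->; [left|left|right|right].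
have g0 u v s t : a <= u -> u <= v -> v <= b -> c <= s -> s <= t -> t <= d ->
    [\/ v < x, x < u, t < y | y < s] -> rect_integral u v s t f = 0.
  move=> au uv vb cs st td H; apply: (Goursat uv st) => p q pu qs.
  apply: df.
  - exact: itv_sub pu.
  - exact: itv_sub qs.
  - move/andP: pu => [up pv]; move/andP: qs => [sq qt].
    apply: complex_neq; case: H => H.
    + by left; rewrite lt_eqF // (le_lt_trans pv).
    + by left; rewrite gt_eqF // (lt_le_trans H).
    + by right; rewrite lt_eqF // (le_lt_trans qt).
    + by right; rewrite gt_eqF // (lt_le_trans H).
have nx1 : x - e != x by rewrite lt_eqF.
have nx2 : x + e != x by rewrite gt_eqF.
have ny1 : y - e != y by rewrite lt_eqF.
have ny2 : y + e != y by rewrite gt_eqF.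
have na : a != x by rewrite lt_eqF // (le_lt_trans ax).
have nb : b != x by rewrite gt_eqF // (lt_le_trans gtx).
have nc : c != y by rewrite lt_eqF // (le_lt_trans cy).
have nd : d != y by rewrite gt_eqF // (lt_le_trans gty).
have l := @lexx _ R.
rewrite (@rect_integral_split_re _ a (x - e) b c d); first last.
- by have [] := bc (x - e) (x - e) c d ax (l _) xb' (l _) cd (l _) (And4 nx1 nx1 nc nd).
- by apply: bc.
- by rewrite ax.
rewrite (g0 a (x - e) c d (l _) ax xb' (l _) cd (l _) (Or41 _ _ _ ltx)) add0r.
rewrite (@rect_integral_split_re _ (x - e) (x + e) b c d); first last.
- by have [] := bc (x + e) (x + e) c d ax' (l _) xb (l _) cd (l _) (And4 nx2 nx2 nc nd).
- by apply: bc.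
- by rewrite xe.
rewrite (g0 (x + e) b c d ax' xb (l _) (l _) cd (l _) (Or42 _ _ _ gtx)) addr0.
rewrite (@rect_integral_split_im _ (x - e) (x + e) c (y - e) d); first last.
- by have [] := bc (x - e) (x + e) (y - e) (y - e) ax xe xb cy (l _) yd'
    (And4 nx1 nx2 ny1 ny1).
- by apply: bc.
- by rewrite cy.
rewrite (g0 (x - e) (x + e) c (y - e) ax xe xb (l _) cy yd' (Or43 _ _ _ lty)) add0r.
rewrite (@rect_integral_split_im _ (x - e) (x + e) (y - e) (y + e) d); first last.
- by have [] := bc (x - e) (x + e) (y + e) (y + e) ax xe xb cy' (l _) yd
    (And4 nx1 nx2 ny2 ny2).
- by apply: bc.
- by rewrite ye.
by rewrite (g0 (x - e) (x + e) (y + e) d ax xe xb cy' yd (l _) (Or44 _ _ _ gty)) addr0.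
Qed.

(** The integrand of the winding number around a point, summed over two
    opposite sides of a square centered there, is a Poisson kernel. *)
Lemma poisson_kernel_primitive (x e t : R) : 0 < e ->
  is_derive t 1 (fun t => 2 * atan ((t - x) / e))
    (2 * e / ((t - x) ^+ 2 + e ^+ 2)).
Proof.
move=> e0; have dG : is_derive t 1 (fun t => (t - x) / e) e^-1.
  by apply: is_derive_eq; rewrite subr0 scaler0 add0r /GRing.scale /= mulr1.
have dH := @is_derive1_comp _ atan (fun t => (t - x) / e) _ _ _
  (is_derive1_atan ((t - x) / e)) dG.
have := is_deriveZ 2 dH.
suff -> : (2 : R) *: ((1 + ((t - x) / e) ^+ 2)^-1 * e^-1) =
  2 * e / ((t - x) ^+ 2 + e ^+ 2) by [].
have p : 0 < (t - x) ^+ 2 + e ^+ 2 by rewrite ltr_wpDl ?sqr_ge0 // exprn_gt0.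
rewrite /GRing.scale /=; field.
by rewrite (gt_eqF p) (gt_eqF e0).
Qed.

Lemma poisson_kernel_continuous (x e t : R) : 0 < e ->
  {for t, continuous (fun t => 2 * e / ((t - x) ^+ 2 + e ^+ 2))}.
Proof.
move=> e0.
have p : 0 < (t - x) ^+ 2 + e ^+ 2 by rewrite ltr_wpDl ?sqr_ge0 // exprn_gt0.
apply: cvgM; first exact: cvg_cst.
apply: cvgV; first by rewrite gt_eqF.
apply: cvgD; last exact: cvg_cst.
rewrite expr2; under eq_fun do rewrite expr2.
by apply: cvgM; (apply: cvgB; [exact: cvg_id|exact: cvg_cst]).
Qed.

Lemma integral_poisson_kernel (x e : R) : 0 < e ->
  rintegral (x - e) (x + e) (fun t => 2 * e / ((t - x) ^+ 2 + e ^+ 2)) = pi.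
Proof.
move=> e0; pose F (t : R) : R := 2 * atan ((t - x) / e).
have xe : x - e < x + e by rewrite ltrBlDr -addrA ltrDl addr_gt0.
have dF t := @poisson_kernel_primitive x e t e0.
have cF t : {for t, continuous F}.
  by apply: differentiable_continuous; apply/derivable1_diffP; have [] := dF t.
rewrite /rintegral /Rintegral (@continuous_FTC2 _ _ F) //.
- rewrite /= /F [x + e]addrC [x - e]addrC !addrK mulNr divff ?gt_eqF //.
  by rewrite atanN atan1; field.
- by apply: continuous_in_subspaceT => t _; exact: poisson_kernel_continuous.
- split.
  + by move=> t _; have [] := dF t.
  + exact/cvg_at_right_filter/cF.
  + exact/cvg_at_left_filter/cF.
- by move=> t _; rewrite derive1E; have [_ ->] := dF t.
Qed.

Lemma rintegral0 (a b : R) : rintegral a b (fun=> 0) = 0.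
Proof. by rewrite /rintegral Rintegral_cst // mul0r. Qed.

Lemma cintegral_real (a b : R) (h : R -> R) :
  cintegral a b (fun u => (h u)%:C) = (rintegral a b h)%:C.
Proof. by rewrite /cintegral -[X in _ +i* X]/(rintegral a b (fun=> 0)) rintegral0. Qed.

Lemma cintegral_imag (a b : R) (h : R -> R) :
  cintegral a b (fun u => 0 +i* h u) = 0 +i* rintegral a b h.
Proof. by rewrite /cintegral -[X in X +i* _]/(rintegral a b (fun=> 0)) rintegral0. Qed.

(** After shrinking to a square centered at the point, each of the two pairs of
    opposite sides contributes [pi]. *)
Lemma winding_number a b c d x y : a < x < b -> c < y < d ->
  rect_integral a b c d (fun z => (z - (x +i* y))^-1) = 0 +i* (2 * pi).
Proof.
move=> /andP[ax xb] /andP[cy yd].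
pose e := Num.min (Num.min (x - a) (b - x)) (Num.min (y - c) (d - y)).
have e0 : 0 < e by rewrite !lt_min !subr_gt0 ax xb cy yd.
have [e1 e2 e3 e4] : [/\ e <= x - a, e <= b - x, e <= y - c & e <= d - y].
  by rewrite !ge_min !lexx !orbT.
have xa : a <= x - e by rewrite lerBrDr addrC -lerBrDr.
have bx : x + e <= b by rewrite addrC -lerBrDr.
have yc : c <= y - e by rewrite lerBrDr addrC -lerBrDr.
have dy : y + e <= d by rewrite addrC -lerBrDr.
rewrite (rect_integral_shrink e0 xa bx yc dy); last first.
  by move=> u v _ _ uv; exact: differentiable_inv_sub.
pose h (x t : R) := 2 * e / ((t - x) ^+ 2 + e ^+ 2).
have p (t : R) : (t - x) ^+ 2 + e ^+ 2 != 0.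
  by rewrite gt_eqF // ltr_wpDl ?sqr_ge0 // exprn_gt0.
have p' (t : R) : (t - y) ^+ 2 + e ^+ 2 != 0.
  by rewrite gt_eqF // ltr_wpDl ?sqr_ge0 // exprn_gt0.
have y1 : y - e - y = - e by ring.
have y2 : y + e - y = e by ring.
have x1 : x - e - x = - e by ring.
have x2 : x + e - x = e by ring.
rewrite /rect_integral (@eq_cintegral _ (x - e) (x + e) _ (fun u => 0 +i* h x u)); last first.
  move=> u _; simpc; rewrite /h y1 y2 sqrrN; congr (_ +i* _); first by rewrite subrr.
  by field; exact: p.
rewrite (@eq_cintegral _ (y - e) (y + e) _ (fun u => (h y u)%:C)); last first.
  move=> u _; simpc; rewrite /h x1 x2 sqrrN (addrC (e ^+ 2)); congr (_ +i* _).
    by field; exact: p'.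
  by rewrite addNr.
rewrite cintegral_real cintegral_imag !integral_poisson_kernel //.
by simpc; congr (_ +i* _); ring.
Qed.

(** The quotient is bounded near the point where it is singular, so its
    integrals along the boundaries of small squares tend to [0]. *)
Lemma removable_quotient a b c d x y f : a < x < b -> c < y < d ->
    (forall u v, a <= u <= b -> c <= v <= d -> differentiable f (u +i* v : C)) ->
  rect_integral a b c d (fun z => (f z - f (x +i* y)) / (z - (x +i* y))) = 0.
Proof.
move=> /andP[ax xb] /andP[cy yd] df; set t : C := x +i* y.
have dt : differentiable f t by apply: df; rewrite ltW //= ltW.
have [A /(_ 1 ltr01)[r r0 Hr]] := differentiable_normc dt.
pose M := normc A + 1.
have M0 : 0 < M by rewrite /M ltr_wpDl ?normc_ge0.
apply: eq0_normc; apply/le_anti; rewrite normc_ge0 andbT.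
apply/ler_addgt0Pr => eps eps0; rewrite add0r.
pose m := Num.min (Num.min (x - a) (b - x)) (Num.min (y - c) (d - y)).
have m0 : 0 < m by rewrite !lt_min !subr_gt0 ax xb cy yd.
pose e := Num.min (Num.min m (r / 3)) (eps / (16 * M)).
have e0 : 0 < e by rewrite 2!lt_min m0 !divr_gt0 // mulr_gt0.
have em : e <= m by rewrite 2!ge_min lexx.
have er : e <= r / 3 by rewrite 2!ge_min lexx orbT.
have eM : e <= eps / (16 * M) by rewrite ge_min lexx orbT.
have [e1 e2 e3 e4] : [/\ e <= x - a, e <= b - x, e <= y - c & e <= d - y].
  by split; apply: le_trans em _; rewrite !ge_min lexx ?orbT.
have xa : a <= x - e by rewrite lerBrDr addrC -lerBrDr.
have bx : x + e <= b by rewrite addrC -lerBrDr.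
have yc : c <= y - e by rewrite lerBrDr addrC -lerBrDr.
have dy : y + e <= d by rewrite addrC -lerBrDr.
have dq u v : a <= u <= b -> c <= v <= d -> (u +i* v : C) != t ->
    differentiable (fun z => (f z - f t) / (z - t)) (u +i* v : C).
  by move=> uab vcd uv; exact: differentiable_quotient (df _ _ uab vcd) uv.
rewrite (rect_integral_shrink e0 xa bx yc dy dq).
have xe : x - e <= x + e by rewrite lerD2l ge0_cp // ltW.
have ye : y - e <= y + e by rewrite lerD2l ge0_cp // ltW.
have nx1 : x - e != x by rewrite lt_eqF // gtrBl.
have nx2 : x + e != x by rewrite gt_eqF // ltrDl.
have ny1 : y - e != y by rewrite lt_eqF // gtrBl.
have ny2 : y + e != y by rewrite gt_eqF // ltrDl.
have qM u v : x - e <= u <= x + e -> y - e <= v <= y + e ->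
    normc ((f (u +i* v) - f t) / (u +i* v - t)) <= M.
  move=> /andP[u1 u2] /andP[v1 v2]; rewrite normcM normcV.
  have [->|wt] := eqVneq (u +i* v : C) t.
    by rewrite subrr normc0 mul0r ltW.
  have n0 : 0 < normc (u +i* v - t).
    rewrite lt_def normc_ge0 andbT; apply: contra_neq wt => /eq0_normc/eqP.
    by rewrite subr_eq0 => /eqP.
  rewrite ler_pdivrMr // /M mulrDl mul1r.
  have -> : f (u +i* v) - f t = A * (u +i* v - t) +
    (f (u +i* v) - f t - A * (u +i* v - t)) by rewrite [RHS]addrC subrK.
  apply: le_trans (ler_normcD _ _) _; rewrite normcM lerD2l.
  rewrite -[leRHS]mul1r; apply: Hr.
  apply: le_lt_trans (normc_le_ReIm _) _; rewrite /t; simpc => /=.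
  have h1 : `|u - x| <= e by rewrite ler_norml; apply/andP; split; lra.
  have h2 : `|v - y| <= e by rewrite ler_norml; apply/andP; split; lra.
  by apply: le_lt_trans (lerD h1 h2) _; lra.
apply: le_trans (@normc_rect_integral _ _ _ _ _ _ M xe ye _ _ _) _.
- apply: (boundary_cont_at _ xe ye) => u v ue ve uv; apply: differentiable_continuous.
  apply: dq; [exact: itv_sub ue|exact: itv_sub ve|].
  by apply: complex_neq; case: uv => ->; [left|left|right|right].
- by move=> u ue; split; apply: qM; rewrite ?lexx ?ye.
- by move=> u ue; split; apply: qM; rewrite ?lexx ?xe.
apply: le_trans (_ : 16 * M * e <= _).
  by rewrite le_eqVlt; apply/orP; left; apply/eqP; ring.
by rewrite mulrC -ler_pdivlMr // mulr_gt0.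
Qed.

Theorem rect_cauchy_formula a b c d x y f : a < x < b -> c < y < d ->
    (forall u v, a <= u <= b -> c <= v <= d -> differentiable f (u +i* v : C)) ->
  rect_integral a b c d (fun z => f z / (z - (x +i* y))) = (0 +i* (2 * pi)) * f (x +i* y).
Proof.
move=> xab ycd df; set t : C := x +i* y.
have /andP[ax xb] := xab; have /andP[cy yd] := ycd.
have ab := ltW (lt_trans ax xb); have cd := ltW (lt_trans cy yd).
have nt u v : [\/ u = a, u = b, v = c | v = d] -> (u +i* v : C) != t.
  move=> uv; apply: complex_neq.
  by case: uv => ->; [left|left|right|right];
    rewrite ?(lt_eqF ax) ?(gt_eqF xb) ?(lt_eqF cy) ?(gt_eqF yd).
have b1 : boundary_cont a b c d (fun z => (z - t)^-1).
  apply: (boundary_cont_at _ ab cd) => u v ue ve uv; apply: differentiable_continuous.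
  exact/differentiable_inv_sub/nt.
have b2 : boundary_cont a b c d (fun z => (f z - f t) / (z - t)).
  apply: (boundary_cont_at _ ab cd) => u v ue ve uv; apply: differentiable_continuous.
  by apply: differentiable_quotient; [exact: df|exact: nt].
have := rect_integral_comb (f t) b1 b2.
rewrite (removable_quotient xab ycd df) (winding_number xab ycd) addr0 mulrC => <-.
by congr rect_integral; apply/funext => z; ring.
Qed.

End Cauchy.

(** * Cauchy integrals on squares centered at the origin *)

Lemma continuous_mul_at (K : numFieldType) (f g : K -> K) (w : K) :
  {for w, continuous f} -> {for w, continuous g} ->
  {for w, continuous (fun w => f w * g w)}.
Proof. exact: continuousM. Qed.

Lemma continuous_add_at (K : numFieldType) (f g : K -> K) (w : K) :
  {for w, continuous f} -> {for w, continuous g} ->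
  {for w, continuous (fun w => f w + g w)}.
Proof. exact: continuousD. Qed.

Lemma continuous_inv_sub (K : numFieldType) (t w : K) : w != t ->
  {for w, continuous (fun z => (z - t)^-1)}.
Proof. by move=> /differentiable_inv_sub/differentiable_continuous. Qed.

Lemma continuous_inv (K : numFieldType) (w : K) : w != 0 ->
  {for w, continuous (fun z : K => z^-1)}.
Proof. by move=> /differentiable_Rinv/differentiable_continuous. Qed.

Section Square.
Context {R : realType}.
Local Notation C := (Num.NumField.sort (complex_complex__canonical__Num_NumField R)).
Local Notation Re := (@complex.Re R).
Local Notation Im := (@complex.Im R).
Implicit Types (r M : R) (f g : C -> C).

(** An open neighbourhood of the boundary of the square of half-side [r]
    centered at [0]: the identities, the bounds and the continuity of
    integrands are easier to state there than on the four sides. *)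
Definition annulus r (z : C) := (3 / 4 * r < normc z) && (normc z < 4 * r).

Definition cauchy_integral r f : C :=
  (0 +i* (2 * pi))^-1 * rect_integral (- r) r (- r) r f.

Lemma annulus_boundary r u v : 0 < r -> - r <= u <= r -> - r <= v <= r ->
  [\/ u = - r, u = r, v = - r | v = r] -> annulus r (u +i* v).
Proof.
move=> r0 ur vr uv; have U : `|u| <= r by rewrite ler_norml.
have V : `|v| <= r by rewrite ler_norml.
have r' : r <= normc (u +i* v).
  case: uv => h.
  - by apply: le_trans (normc_Re (u +i* v)); rewrite /= h normrN ger0_norm // ltW.
  - by apply: le_trans (normc_Re (u +i* v)); rewrite /= h ger0_norm // ltW.
  - by apply: le_trans (normc_Im (u +i* v)); rewrite /= h normrN ger0_norm // ltW.
  - by apply: le_trans (normc_Im (u +i* v)); rewrite /= h ger0_norm // ltW.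
have r4 := normc_le_ReIm (u +i* v); rewrite /= in r4.
by apply/andP; split; [apply: lt_le_trans r'; lra|apply: le_lt_trans r4 _; lra].
Qed.

Lemma annulus_sides r x : 0 < r -> - r <= x <= r ->
  [/\ annulus r (x +i* - r), annulus r (x +i* r), annulus r (- r +i* x)
    & annulus r (r +i* x)].
Proof.
move=> r0 xr; have rr : - r <= - r <= r by rewrite lexx ge0_cp // ltW.
have rr' : - r <= r <= r by rewrite lexx andbT ge0_cp // ltW.
split; apply: annulus_boundary => //.
- exact: Or43.
- exact: Or44.
- exact: Or41.
- exact: Or42.
Qed.

Lemma boundary_cont_annulus r f : 0 < r ->
  (forall z, annulus r z -> {for z, continuous f}) -> boundary_cont (- r) r (- r) r f.
Proof.
move=> r0 cf; have rr : - r <= r by lra.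
apply: (boundary_cont_at _ rr rr) => x y xr yr xy; apply: cf.
exact: annulus_boundary.
Qed.

Lemma eq_cauchy_integral r f g : 0 < r -> (forall z, annulus r z -> f z = g z) ->
  cauchy_integral r f = cauchy_integral r g.
Proof.
move=> r0 fg.
rewrite /cauchy_integral /rect_integral.
congr (_ * (_ + _ * _)); apply: eq_cintegral => x xr;
by have [h1 h2 h3 h4] := annulus_sides r0 xr; congr (_ - _); exact: fg.
Qed.

Lemma cauchy_integral_comb r (k : C) f g : 0 < r ->
    (forall z, annulus r z -> {for z, continuous f}) ->
    (forall z, annulus r z -> {for z, continuous g}) ->
  cauchy_integral r (fun z => k * f z + g z) = k * cauchy_integral r f + cauchy_integral r g.
Proof.
move=> r0 cf cg; have bf := boundary_cont_annulus r0 cf; have bg := boundary_cont_annulus r0 cg.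
rewrite /cauchy_integral (rect_integral_comb k bf bg).
ring.
Qed.

Lemma cauchy_integralD r f g : 0 < r ->
    (forall z, annulus r z -> {for z, continuous f}) ->
    (forall z, annulus r z -> {for z, continuous g}) ->
  cauchy_integral r (fun z => f z + g z) = cauchy_integral r f + cauchy_integral r g.
Proof.
move=> r0 cf cg; rewrite -[X in X + _]mul1r -(cauchy_integral_comb 1 r0 cf cg).
by apply: eq_cauchy_integral => // z _; rewrite mul1r.
Qed.

Lemma normc_cauchy_integral r f M : 0 < r ->
    (forall z, annulus r z -> {for z, continuous f}) ->
    (forall z, annulus r z -> normc (f z) <= M) ->
  normc (cauchy_integral r f) <= 16 * M * r.
Proof.
move=> r0 cf fM; rewrite /cauchy_integral normcM normcV.
have -> : normc (0 +i* (2 * pi)) = 2 * pi :> R.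
  by rewrite /= expr0n add0r sqrtr_sqr ger0_norm // mulr_ge0 // pi_ge0.
have rr : - r <= r by lra.
have rb : normc (rect_integral (- r) r (- r) r f) <= 16 * M * r.
  apply: le_trans (normc_rect_integral rr rr (boundary_cont_annulus r0 cf) _ _) _; last first.
  - by rewrite le_eqVlt; apply/orP; left; apply/eqP; instantiate (1 := M); ring.
  - move=> y yr; have [h1 h2 h3 h4] := annulus_sides r0 yr; split; exact: fM.
  - move=> y yr; have [h1 h2 h3 h4] := annulus_sides r0 yr; split; exact: fM.
apply: le_trans rb; rewrite ler_piMl ?normc_ge0 // invf_le1 ?mulr_gt0 ?pi_gt0 //.
by have := pi_ge2 R; lra.
Qed.

Lemma annulus_neq0 r z : 0 < r -> annulus r z -> z != 0.
Proof.
move=> r0 /andP[zr _]; apply: contraTneq zr => ->.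
by rewrite normc0 -leNgt; apply: mulr_ge0; [lra|exact: ltW].
Qed.

Lemma annulus_sub r z (t : C) : 0 < r -> annulus r z -> normc t <= r / 2 ->
  r / 4 <= normc (z - t).
Proof.
move=> r0 /andP[zr _] tr; have := ler_normcD (z - t) t; rewrite subrK => h; lra.
Qed.

Lemma annulus_neq r z (t : C) : 0 < r -> annulus r z -> normc t <= r / 2 -> z != t.
Proof.
move=> r0 zr tr; have := annulus_sub r0 zr tr; apply: contraTneq => ->.
by rewrite subrr normc0 -ltNge divr_gt0.
Qed.

Lemma cauchy_integral_formula r f (t : C) : 0 < r ->
    (forall z : C, normc z < 4 * r -> differentiable f z) -> normc t <= r / 2 ->
  f t = cauchy_integral r (fun z => f z / (z - t)).
Proof.
move=> r0 df; case: t => x y tr.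
have x1 := le_trans (normc_Re (x +i* y)) tr.
have y1 := le_trans (normc_Im (x +i* y)) tr.
move: x1 y1; rewrite /= !ler_norml => /andP[x1 x2] /andP[y1 y2].
rewrite /cauchy_integral rect_cauchy_formula; first last.
- move=> u v ur vr; apply: df; apply: le_lt_trans (normc_le_ReIm _) _ => /=.
  have U : `|u| <= r by rewrite ler_norml.
  have V : `|v| <= r by rewrite ler_norml.
  by apply: le_lt_trans (lerD U V) _; lra.
- by apply/andP; split; lra.
- by apply/andP; split; lra.
rewrite mulKf // eq_complex /= eqxx /= mulf_neq0 ?pnatr_eq0 //.
by rewrite gt_eqF ?pi_gt0.
Qed.

End Square.

(** * Bounds on the second order remainder *)

Section Taylor.
Context {R : realType}.
Local Notation C := (Num.NumField.sort (complex_complex__canonical__Num_NumField R)).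
Implicit Types (r M : R) (f g : C -> C).

(** The difference of [f t] and of the first two terms is the Cauchy integral
    of [f z] times [(z - t)^-1 - z^-1 - t z^-2 = t^2 z^-2 (z - t)^-1]. *)
Lemma cauchy_taylor r M f (t : C) : 0 < r ->
    (forall z : C, normc z < 4 * r -> differentiable f z /\ normc (f z) <= M) ->
    normc t <= r / 2 ->
  normc (f t - f 0 - cauchy_integral r (fun z => f z / z ^+ 2) * t) <=
    128 * M / r ^+ 2 * normc t ^+ 2.
Proof.
move=> r0 fP tr.
have df (z : C) : normc z < 4 * r -> differentiable f z by move=> /fP[].
have zr : normc (0 : C) <= r / 2 by rewrite normc0 divr_ge0 // ltW.
have cf z : annulus r z -> {for z, continuous f}.
  by move=> /andP[_ /df]; exact: differentiable_continuous.
have ci z : annulus r z -> {for z, continuous (fun z : C => z^-1)}.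
  by move=> /(annulus_neq0 r0); exact: continuous_inv.
have ct z : annulus r z -> {for z, continuous (fun z : C => (z - t)^-1)}.
  by move=> za; apply/continuous_inv_sub/(annulus_neq r0 za tr).
pose F1 (z : C) := f z * z^-1.
pose F2 (z : C) := (f z * z^-1) * z^-1.
pose F3 (z : C) := t ^+ 2 * (((f z * z^-1) * z^-1) * (z - t)^-1).
have c1 z : annulus r z -> {for z, continuous F1}.
  by move=> za; apply: continuous_mul_at; [exact: cf|exact: ci].
have c2 z : annulus r z -> {for z, continuous F2}.
  by move=> za; apply: continuous_mul_at; [exact: c1|exact: ci].
have c3 z : annulus r z -> {for z, continuous F3}.
  move=> za; apply: continuous_mul_at; first exact: cst_continuous.
  by apply: continuous_mul_at; [exact: c2|exact: ct].
have c23 z : annulus r z -> {for z, continuous (fun z => t * F2 z + F3 z)}.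
  move=> za; apply: continuous_add_at; last exact: c3.
  by apply: continuous_mul_at; [exact: cst_continuous|exact: c2].
have -> : f t = cauchy_integral r F1 + (t * cauchy_integral r F2 + cauchy_integral r F3).
  rewrite (cauchy_integral_formula r0 df tr).
  rewrite -(cauchy_integral_comb t r0 c2 c3) -(cauchy_integralD r0 c1 c23).
  apply: (eq_cauchy_integral r0) => z za; rewrite /F1 /F2 /F3; field.
  by rewrite (annulus_neq0 r0 za) subr_eq0 (annulus_neq r0 za tr).
have -> : f 0 = cauchy_integral r F1.
  rewrite (cauchy_integral_formula r0 df zr); apply: (eq_cauchy_integral r0) => z _.
  by rewrite subr0.
have -> : cauchy_integral r (fun z => f z / z ^+ 2) = cauchy_integral r F2.
  by apply: (eq_cauchy_integral r0) => z _; rewrite /F2 -mulrA -invfM expr2.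
have -> : cauchy_integral r F1 +
    (t * cauchy_integral r F2 + cauchy_integral r F3) - cauchy_integral r F1 -
    cauchy_integral r F2 * t = cauchy_integral r F3 by ring.
have M0 : 0 <= M.
  have z4 : normc (0 : C) < 4 * r by rewrite normc0 mulr_gt0.
  by have [_] := fP 0 z4; apply: le_trans; exact: normc_ge0.
apply: le_trans (normc_cauchy_integral r0 c3
  (_ : forall z, _ -> _ <= 8 * M * normc t ^+ 2 / r ^+ 3)) _.
  move=> z za; have /andP[zr1 zr4] := za; have [_ fM] := fP _ zr4.
  rewrite /F3 !normcM !normcV expr2.
  have a0 : 0 < 3 / 4 * r by rewrite mulr_gt0 // divr_gt0.
  have b0 : 0 < r / 4 by rewrite divr_gt0.
  have h1 : (normc z)^-1 <= (3 / 4 * r)^-1.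
    by rewrite lef_pV2 ?posrE ?(ltW zr1) //; exact: lt_trans zr1.
  have h2 : (normc (z - t))^-1 <= (r / 4)^-1.
    have h := annulus_sub r0 za tr.
    by rewrite lef_pV2 ?posrE //; exact: lt_le_trans h.
  have i1 : 0 <= (normc z)^-1 by rewrite invr_ge0 normc_ge0.
  have i2 : 0 <= (normc (z - t))^-1 by rewrite invr_ge0 normc_ge0.
  have h := ler_pM (normc_ge0 _) i1 fM h1.
  have {}h := ler_pM (mulr_ge0 (normc_ge0 (f z)) i1) i1 h h1.
  have {}h := ler_pM (mulr_ge0 (mulr_ge0 (normc_ge0 (f z)) i1) i1) i2 h h2.
  rewrite -expr2 [leRHS]mulrAC mulrC; apply: ler_pM => //.
  - by rewrite !mulr_ge0 // normc_ge0.
  - by rewrite exprn_ge0 // normc_ge0.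
  apply: le_trans h _.
  have -> : M * (3 / 4 * r)^-1 * (3 / 4 * r)^-1 * (r / 4)^-1 = 64 / 9 * M / r ^+ 3.
    by field; rewrite gt_eqF.
  rewrite ler_wpM2r ?invr_ge0 ?exprn_ge0 ?(ltW r0) // ler_wpM2r //; lra.
by rewrite le_eqVlt; apply/orP; left; apply/eqP; field; rewrite gt_eqF.
Qed.

(** By [cauchy_taylor], the Cauchy integral has the property that
    characterizes the derivative at [0]. *)
Lemma cauchy_derivative r M f (A : C) : 0 < r ->
    (forall z : C, normc z < 4 * r -> differentiable f z /\ normc (f z) <= M) ->
    (forall e : R, 0 < e -> exists2 d : R, 0 < d & forall t, normc t < d ->
      normc (f t - f 0 - A * t) <= e * normc t) ->
  A = cauchy_integral r (fun z => f z / z ^+ 2).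
Proof.
move=> r0 fP fA; set B := cauchy_integral _ _.
have M0 : 0 <= M.
  have z4 : normc (0 : C) < 4 * r by rewrite normc0 mulr_gt0.
  by have [_] := fP 0 z4; apply: le_trans; exact: normc_ge0.
apply/eqP; rewrite -subr_eq0; apply/eqP/eq0_normc/le_anti; rewrite normc_ge0 andbT.
apply/ler_addgt0Pr => e e0; rewrite add0r.
have [|d d0 dP] := fA (e / 2); first by rewrite divr_gt0.
pose K := 128 * M / r ^+ 2.
have K0 : 0 <= K by rewrite !mulr_ge0 // invr_ge0 exprn_ge0 // ltW.
pose s := Num.min (Num.min (d / 2) (r / 2)) (e / 2 / (K + 1)).
have K1 : 0 < K + 1 by rewrite ltr_wpDl.
have s0 : 0 < s by rewrite 2!lt_min !divr_gt0.
have sd : s < d.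
  have h : s <= d / 2 by rewrite /s 2!ge_min lexx.
  by apply: le_lt_trans h _; lra.
have sr : s <= r / 2 by rewrite /s 2!ge_min lexx orbT.
have sK : s <= e / 2 / (K + 1) by rewrite /s ge_min lexx orbT.
have ns : normc (s%:C : C) = s by rewrite normcR ger0_norm // ltW.
have := dP s%:C; rewrite ns => /(_ sd) h1.
have := cauchy_taylor r0 fP (t := s%:C); rewrite ns => /(_ sr); rewrite -/B -/K => h2.
have h3 : normc (A - B) * s <= e / 2 * s + K * s ^+ 2.
  rewrite -[X in _ * X]ns -normcM.
  have -> : (A - B) * s%:C = - (f s%:C - f 0 - A * s%:C) + (f s%:C - f 0 - B * s%:C) by ring.
  by apply: le_trans (ler_normcD _ _) _; rewrite normcN; exact: lerD.
rewrite -(ler_pM2r s0); apply: le_trans h3 _.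
have h4 : K * s <= e / 2.
  move: sK; rewrite ler_pdivlMr // => sK.
  by apply: le_trans sK; rewrite mulrC ler_wpM2l ?(ltW s0) // lerDl.
have -> : e * s = e / 2 * s + e / 2 * s by rewrite -mulrDl -splitr.
by rewrite lerD2l expr2 mulrA ler_wpM2r // ltW.
Qed.

Lemma taylor_bound r M f (A t : C) : 0 < r ->
    (forall z : C, normc z < 4 * r -> differentiable f z /\ normc (f z) <= M) ->
    (forall e : R, 0 < e -> exists2 d : R, 0 < d & forall t, normc t < d ->
      normc (f t - f 0 - A * t) <= e * normc t) -> normc t <= r / 2 ->
  normc (f t - f 0 - A * t) <= 128 * M / r ^+ 2 * normc t ^+ 2.
Proof.
move=> r0 fP fA tr; rewrite (cauchy_derivative r0 fP fA); exact: cauchy_taylor.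
Qed.

End Taylor.

Lemma differentiable_line (K : numFieldType) (V : normedModType K) (z w : V) (t : K) :
  differentiable (fun t : K => z + t *: w) t.
Proof.
apply: (@differentiableD _ _ _ (cst z) (fun t : K => t *: w)); first exact: differentiable_cst.
by apply: (@differentiableZl _ _ _ id); exact: ex_diff.
Qed.

Section Several.
Context {R : realType} {n : nat}.
Local Notation C := (Num.NumField.sort (complex_complex__canonical__Num_NumField R)).
Local Notation V := 'cV[C]_n.
Implicit Types (g : V -> C) (w z : V).

(** The norm of a vector is a nonnegative complex number; this is that number
    as a real one. *)
Definition vnorm w : R := complex.Re `|w|.

Lemma vnormE w : `|w| = (vnorm w)%:C.
Proof.
have w0 : 0 <= `|w| := normr_ge0 w.
by rewrite /vnorm RRe_real //; exact: ger0_real w0.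
Qed.

Lemma vnorm_ge0 w : 0 <= vnorm w.
Proof.
have w0 : 0 <= `|w| := normr_ge0 w.
by move: w0; rewrite vnormE ler0c.
Qed.

Lemma ler_vnormD w z : vnorm (w + z) <= vnorm w + vnorm z.
Proof. by rewrite -lecR rmorphD /= -!vnormE; exact: ler_normD. Qed.

Lemma vnormZ (a : C) w : vnorm (a *: w) = normc a * vnorm w.
Proof. by apply: complexI; rewrite -vnormE normrZ normcE vnormE rmorphM. Qed.

Lemma vnorm0_eq0 w : vnorm w = 0 -> w = 0.
Proof. by move=> h; apply: normr0_eq0; rewrite vnormE h. Qed.

Lemma near_vnorm (z : V) (P : V -> Prop) :
  (\forall w \near z, P w) <->
  exists2 d : R, 0 < d & forall w, vnorm (w - z) < d -> P w.
Proof.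
split=> [H0|[d d0 H]].
  have /(nbhs_ballP z P)[d /= /complex_gt0[dE d0] H] : nbhs z P := H0.
  exists (complex.Re d) => // w wz; apply: H; rewrite dE.
  by rewrite -ball_normE /= distrC vnormE ltcR.
suff : nbhs z P by [].
apply/(nbhs_ballP z P); exists d%:C; first by rewrite /= ltcR.
by move=> w; rewrite -ball_normE /= distrC vnormE ltcR => /H.
Qed.

Lemma differentiable_vnorm g z : differentiable g z ->
  forall e : R, 0 < e -> exists2 d : R, 0 < d & forall w, vnorm w < d ->
    normc (g (z + w) - g z - 'd g z w) <= e * vnorm w.
Proof.
move=> dg e e0; have := differentiable_dist dg; move=> /(_ e%:C).
rewrite ltcR => /(_ e0) /near_vnorm[d d0 H]; exists d => // w wd.
have := H w; rewrite subr0 => /(_ wd).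
by rewrite (addrC w) normcE vnormE -rmorphM lecR.
Qed.

Lemma linear_coord (f : {linear V -> C}) w : f w = \sum_(j < n) w j 0 * f (delta_mx j 0).
Proof.
rewrite {1}[w]matrix_sum_delta linear_sum; apply: eq_bigr => j _.
by rewrite big_ord1 linearZ.
Qed.

Lemma linear_continuous_cV (f : {linear V -> C}) : continuous f.
Proof.
move=> w; apply: differentiable_continuous.
have -> : (f : V -> C) = \sum_(j < n) (fun w : V => w j 0 * f (delta_mx j 0)).
  by apply/funext => z; rewrite linear_coord fct_sumE.
apply: differentiable_sum => j.
apply: (@differentiableM _ _ (fun w : V => w j 0) (cst (f (delta_mx j 0)))).
  exact: differentiable_coord.
exact: differentiable_cst.
Qed.

(** Apply the bound in one variable to the restriction of [g] to the line
    through [z] and [z + w].  The constant does not depend on [g] otherwise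
    than by [M], which makes the bound uniform over families of functions. *)
Lemma several_taylor g z (d M : R) w : 0 < d ->
    (forall w, vnorm w < d -> differentiable g (z + w) /\ normc (g (z + w)) <= M) ->
    vnorm w <= d / 16 ->
  normc (g (z + w) - g z - 'd g z w) <= 128 * 64 * M / d ^+ 2 * vnorm w ^+ 2.
Proof.
move=> d0 gP wd; have [/eqP/vnorm0_eq0->|w0] := boolP (vnorm w == 0).
  have z0 : vnorm (0 : V) < d by rewrite /vnorm normr0.
  have M0 : 0 <= M by have [_] := gP 0 z0; apply: le_trans; exact: normc_ge0.
  have -> : 'd g z 0 = 0 by exact: linear0.
  rewrite addr0.
  rewrite subrr.
  rewrite subr0 normc0.
  apply: mulr_ge0; last exact: sqr_ge0.
  apply: mulr_ge0; last by rewrite invr_ge0 sqr_ge0.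
  by rewrite mulr_ge0 ?M0 // -natrM ler0n.
have {}w0 : 0 < vnorm w by rewrite lt_def w0 vnorm_ge0.
pose f (t : C) := g (z + t *: w).
pose r := d / (8 * vnorm w).
have r0 : 0 < r by rewrite divr_gt0 // mulr_gt0.
have fP (t : C) : normc t < 4 * r -> differentiable f t /\ normc (f t) <= M.
  move=> tr; have tw : vnorm (t *: w) < d.
    rewrite vnormZ -ltr_pdivlMr //; apply: lt_le_trans tr _.
    rewrite /r invfM !mulrA ler_wpM2r ?invr_ge0 ?ltW //; lra.
  have [dg gM] := gP _ tw; split=> //.
  by apply: (@differentiable_comp _ _ _ _ (fun t : C => z + t *: w) g); first exact: differentiable_line.
have fA e : 0 < e -> exists2 d : R, 0 < d & forall t, normc t < d ->
    normc (f t - f 0 - 'd g z w * t) <= e * normc t.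
  move=> e0; have z0 : vnorm (0 : V) < d by rewrite /vnorm normr0.
  have [dg _] := gP 0 z0; rewrite addr0 in dg.
  have [|d' d'0 H] := differentiable_vnorm dg (e := e / vnorm w); first by rewrite divr_gt0.
  exists (d' / vnorm w); first by rewrite divr_gt0.
  move=> t td; have := H (t *: w); rewrite vnormZ -ltr_pdivlMr // => /(_ td).
  have -> : 'd g z (t *: w) = 'd g z w * t by rewrite linearZ mulrC.
  rewrite /f scale0r addr0 => /le_trans; apply.
  by rewrite mulrA mulrAC divfK // gt_eqF.
have t1 : normc (1 : C) <= r / 2.
  by rewrite normc1 /r -mulrA -invfM ler_pdivlMr ?mul1r ?mulr_gt0 //; lra.
have := taylor_bound r0 fP fA t1.
rewrite /f scale1r scale0r addr0 mulr1 normc1 expr1n mulr1 => /le_trans; apply.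
by rewrite le_eqVlt; apply/orP; left; apply/eqP; rewrite /r; field; rewrite !gt_eqF.
Qed.

End Several.

(** * Differentiation under the integral sign *)

Section UnderIntegral.
Context {R : realType} {n : nat}.
Local Notation C := (Num.NumField.sort (complex_complex__canonical__Num_NumField R)).
Local Notation V := 'cV[C]_n.

Lemma annulus_near (r : R) (z : C) : annulus r z ->
  exists2 d : R, 0 < d & forall z', normc (z' - z) < d -> annulus r z'.
Proof.
move=> /andP[z1 z2].
exists (Num.min (normc z - 3 / 4 * r) (4 * r - normc z)).
  by rewrite lt_min !subr_gt0 z1 z2.
move=> z'; rewrite lt_min => /andP[h1 h2].
have t1 := ler_normcD (z' - z) z; rewrite subrK in t1.
have t2 := ler_normcD (z - z') z'; rewrite subrK normc_distC in t2.
by apply/andP; split; lra.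
Qed.

Lemma continuous_uniform (r : R) (D : C -> C) (z : C) : annulus r z ->
    (forall e : R, 0 < e -> exists2 q : C -> C, {for z, continuous q} &
      forall z', annulus r z' -> normc (q z' - D z') <= e) ->
  {for z, continuous D}.
Proof.
move=> za Dq; apply/(cvg_normc (nbhs_filter z)) => e e0.
have [|q cq qD] := Dq (e / 4); first by rewrite divr_gt0.
have [|d1 d10 H1] := continuous_normc cq (e := e / 4); first by rewrite divr_gt0.
have [d2 d20 H2] := annulus_near za.
apply/near_normc; exists (Num.min d1 d2); first by rewrite lt_min d10.
move=> z'; rewrite lt_min => /andP[/H1 h1 /H2 h2].
have -> : D z' - D z = (q z' - q z) + ((q z - D z) - (q z' - D z')) by ring.
apply: le_lt_trans (ler_normcD _ _) _.
have t := ler_normcD (q z - D z) (- (q z' - D z')); rewrite normcN in t.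
have := qD _ za; have := qD _ h2 => g1 g2; lra.
Qed.

(** The candidate for the differential is the Cauchy integral of the
    differentials of the [Phi u]; they depend continuously on [u], as uniform
    limits of difference quotients, and [several_taylor] bounds the remainder
    uniformly in [u]. *)
Lemma differentiable_cauchy_integral (Phi : C -> V -> C) (z0 : V) (r d M : R) :
    0 < r -> 0 < d ->
    (forall u w, annulus r u -> vnorm w < d ->
      differentiable (Phi u) (z0 + w) /\ normc (Phi u (z0 + w)) <= M) ->
    (forall u w, annulus r u -> vnorm w < d ->
      {for u, continuous (Phi^~ (z0 + w))}) ->
  differentiable (fun z => cauchy_integral r (Phi^~ z)) z0.
Proof.
move=> r0 d0 PhiP cPhi; set h := fun z => _.
pose K := 128 * 64 * M / d ^+ 2.
pose D w u : C := 'd (Phi u) z0 w.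
have E u w : annulus r u -> vnorm w <= d / 16 ->
    normc (Phi u (z0 + w) - Phi u z0 - D w u) <= K * vnorm w ^+ 2.
  by move=> ua wd; apply: several_taylor => // w'; exact: PhiP.
have nv0 : vnorm (0 : V) < d by rewrite /vnorm normr0.
have c0 u : annulus r u -> {for u, continuous (Phi^~ z0)}.
  by move=> ua; have := cPhi u 0 ua nv0; rewrite addr0.
have K0 : 0 <= K.
  have ra : annulus r r%:C.
    by rewrite /annulus normcR ger0_norm ?ltW //; apply/andP; split; lra.
  have [_ h0] := PhiP _ _ ra nv0; have M0 := le_trans (normc_ge0 _) h0.
  apply: mulr_ge0; last by rewrite invr_ge0 sqr_ge0.
  by rewrite mulr_ge0 ?M0 // -natrM ler0n.
(* the step [s] makes the difference quotients [e]-close to the differential *)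
have cD w u : annulus r u -> {for u, continuous (D w)}.
  move=> ua; apply: (continuous_uniform ua) => e e0.
  pose k := vnorm w; have k0 : 0 <= k := vnorm_ge0 w.
  pose s := Num.min (d / 16 / (k + 1)) (e / (K * k ^+ 2 + 1)).
  have Kk : 0 <= K * k ^+ 2 by rewrite mulr_ge0 // sqr_ge0.
  have k1 : 0 < k + 1 by rewrite ltr_wpDl.
  have k2 : 0 < K * k ^+ 2 + 1 by rewrite ltr_wpDl.
  have s0 : 0 < s by rewrite lt_min !divr_gt0.
  have s1 : s <= d / 16 / (k + 1) by rewrite ge_min lexx.
  have s2 : s <= e / (K * k ^+ 2 + 1) by rewrite ge_min lexx orbT.
  have ns : vnorm (s%:C *: w) = s * k by rewrite vnormZ normcR ger0_norm // ltW.
  have sd : s * k <= d / 16.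
    apply: le_trans (_ : s * (k + 1) <= _); first by rewrite ler_wpM2l ?lerDl // ltW.
    by rewrite -ler_pdivlMr.
  have sdd : vnorm (s%:C *: w) < d by rewrite ns; apply: le_lt_trans sd _; lra.
  exists (fun u => (Phi u (z0 + s%:C *: w) - Phi u z0) * (s%:C)^-1).
    apply: continuous_mul_at; last exact: cst_continuous.
    by apply: continuousB_at; [exact: cPhi|exact: c0].
  move=> u' u'a; have := E u' (s%:C *: w) u'a; rewrite ns => /(_ sd).
  have -> : D (s%:C *: w) u' = D w u' * s%:C by rewrite /D linearZ mulrC.
  move=> h1; rewrite -(ler_pM2r s0) -[X in normc _ * X](ger0_norm (ltW s0)) -normcR -normcM.
  have sC : s%:C != 0 :> C by apply: contra_neq (lt0r_neq0 s0) => /complexI.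
  rewrite mulrBl divfK //; apply: le_trans h1 _.
  have -> : K * (s * k) ^+ 2 = s * (K * k ^+ 2) * s by ring.
  rewrite ler_wpM2r ?(ltW s0) //.
  apply: le_trans (_ : s * (K * k ^+ 2 + 1) <= _); last by rewrite -ler_pdivlMr.
  by rewrite ler_wpM2l ?lerDl // ltW.
pose L w := cauchy_integral r (D w).
have linL : linear L.
  move=> a w w'; rewrite /L -(cauchy_integral_comb a r0 (@cD w) (@cD w')).
  by apply: (eq_cauchy_integral r0) => u _; rewrite /D linearP.
pose L' : {linear V -> C} := HB.pack L (GRing.isLinear.Build _ _ _ _ L linL).
apply: (@dist_differentiable _ _ _ h z0 L'); first exact: linear_continuous_cV.
move=> e /complex_gt0[eE]; set e' := complex.Re e => e0.
pose K' := 16 * K * r.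
have K'0 : 0 <= K' by rewrite /K' mulr_ge0 ?(ltW r0) // mulr_ge0.
have K'1 : 0 < K' + 1 by rewrite ltr_wpDl.
apply/near_vnorm; exists (Num.min (d / 16) (e' / (K' + 1))); first by rewrite lt_min !divr_gt0.
move=> w; rewrite subr0 lt_min => /andP[w1 w2].
rewrite eE normcE vnormE -rmorphM lecR.
have wd : vnorm w < d by apply: lt_trans w1 _; lra.
have cw u : annulus r u -> {for u, continuous (Phi^~ (z0 + w))}.
  by move=> ua; exact: cPhi.
have cneg (F : C -> C) u : {for u, continuous F} -> {for u, continuous (fun u => -1 * F u)}.
  by move=> cF; apply: continuous_mul_at; [exact: cst_continuous|exact: cF].
have cdif u : annulus r u -> {for u, continuous (fun u => -1 * Phi u z0 + Phi u (z0 + w))}.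
  by move=> ua; apply: continuous_add_at; [apply: cneg; exact: c0|exact: cw].
have -> : h (w + z0) - h z0 - L w =
    cauchy_integral r (fun u => -1 * D w u + (-1 * Phi u z0 + Phi u (z0 + w))).
  rewrite (cauchy_integral_comb (-1) r0 (@cD w) cdif) (cauchy_integral_comb (-1) r0 c0 cw).
  by rewrite /h (addrC w) -/(L w); ring.
apply: le_trans (normc_cauchy_integral r0 (M := K * vnorm w ^+ 2) _ _) _.
- move=> u ua; apply: continuous_add_at; last exact: cdif.
  by apply: cneg; exact: cD.
- move=> u ua; have := E u w ua (ltW w1).
  suff -> : Phi u (z0 + w) - Phi u z0 - D w u =
    -1 * D w u + (-1 * Phi u z0 + Phi u (z0 + w)) by [].
  ring.
have -> : 16 * (K * vnorm w ^+ 2) * r = (vnorm w * K') * vnorm w by rewrite /K'; ring.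
rewrite ler_wpM2r ?vnorm_ge0 //.
apply: le_trans (_ : vnorm w * (K' + 1) <= _); first by rewrite ler_wpM2l ?vnorm_ge0 // lerDl.
by rewrite -ler_pdivlMr // ltW.
Qed.
End UnderIntegral.

(** * Division by a linear form *)

Section Division.
Context {R : realType} {n : nat}.
Local Notation C := (Num.NumField.sort (complex_complex__canonical__Num_NumField R)).
Local Notation V := 'cV[C]_n.

Lemma differentiable_near (f g : V -> C) z :
  (\forall w \near z, f w = g w) -> differentiable f z -> differentiable g z.
Proof.
move=> /near_vnorm[d d0 fg] df.
apply: (@dist_differentiable _ _ _ g z ('d f z)); first exact: linear_continuous_cV.
move=> e e0; have /near_vnorm[d' d'0 H] := differentiable_dist df e0.
apply/near_vnorm; exists (Num.min d d'); first by rewrite lt_min d0.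
move=> w; rewrite lt_min => /andP[wd wd'].
have nv0 : vnorm (z - z) < d by rewrite subrr /vnorm normr0.
rewrite -(fg z nv0) -(fg (w + z)); last by rewrite addrK -[w]subr0.
exact: H.
Qed.

Lemma linear_differentiable_cV (f : {linear V -> C}) z : differentiable f z.
Proof. by apply: linear_differentiable; exact: linear_continuous_cV. Qed.

(** Outside the kernel of [l] the quotient is [g / l].  At a point of the
    kernel its value is the derivative of [g] in the direction [v].  Near such
    a point, the restriction of [g] to a line of direction [v] vanishes where
    the line meets the kernel, and the Cauchy formula on that line expresses
    the quotient as a Cauchy integral on a fixed square. *)
Lemma holomorphic_division (Omega : set V) (l : {linear V -> C}) (v : V) (g : V -> C) :
    open Omega -> l v = 1 -> (forall z, Omega z -> differentiable g z) ->
    (forall z, Omega z -> l z = 0 -> g z = 0) ->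
  exists2 h : V -> C, (forall z, Omega z -> differentiable h z) &
    (forall z, Omega z -> g z = l z * h z).
Proof.
move=> oO lv dg g0; exists (fun z => if l z == 0 then 'd g z v else g z / l z); last first.
  move=> z Oz; case: ifPn => [/eqP lz|lz]; first by rewrite lz mul0r g0.
  by rewrite mulrC divfK.
move=> z0 Oz0; have [/eqP lz0|lz0] := boolP (l z0 == 0); last first.
  have dq : differentiable (fun z => g z / l z) z0.
    apply: (@differentiableM _ _ g (fun z => (l z)^-1)); first exact: dg.
    by apply: differentiableV; [exact: linear_differentiable_cV|exact: lz0].
  apply: (differentiable_near _ dq).
  have cl : {for z0, continuous l} by exact: linear_continuous_cV.
  have n0 : 0 < normc (l z0).
    by rewrite lt_def normc_ge0 andbT; apply: contra_neq lz0 => /eq0_normc.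
  have := (cvg_normc (nbhs_filter z0) l (l z0)).2 cl _ n0.
  apply: filterS => z zl; case: ifPn => // /eqP lz; move: zl.
  by rewrite lz sub0r normcN ltxx.
set h := fun z => _.
pose c := vnorm v; have c0 : 0 <= c := vnorm_ge0 v.
have c1 : 0 < c + 1 by rewrite ltr_wpDl.
have [d d0 dP] : exists2 d : R, 0 < d & forall z, vnorm (z - z0) < d ->
    Omega z /\ normc (g z) <= 1.
  have cg : {for z0, continuous g} by exact: differentiable_continuous (dg _ Oz0).
  have := (cvg_normc (nbhs_filter z0) g (g z0)).2 cg _ ltr01.
  rewrite (g0 _ Oz0 lz0) => /near_vnorm[d1 d10 H1].
  have /near_vnorm[d2 d20 H2] : nbhs z0 Omega by exact: open_nbhs_nbhs.
  exists (Num.min d1 d2); first by rewrite lt_min d10.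
  move=> z; rewrite lt_min => /andP[/H1 h1 /H2 h2]; split=> //.
  by move: h1; rewrite subr0 => /ltW.
(* small enough for the points of the lines below with parameter less than
   [4 * r] to stay in the ball of radius [d], where [g] is bounded by [1] *)
pose r := d / (16 * (c + 1)).
have r0 : 0 < r by rewrite divr_gt0 // mulr_gt0.
have rc : r * c <= d / 16.
  apply: le_trans (_ : r * (c + 1) <= _); first by rewrite ler_wpM2l ?lerDl // ltW.
  by rewrite /r invfM mulrA divfK // gt_eqF.
have [d' d'0 [d'd lr]] : exists2 d' : R, 0 < d' & d' <= d / 4 /\
    forall w, vnorm w < d' -> normc (l w) <= r / 2.
  have cl : {for (0 : V), continuous l} by exact: linear_continuous_cV.
  have r2 : 0 < r / 2 by rewrite divr_gt0.
  have := (cvg_normc (nbhs_filter (0 : V)) l (l 0)).2 cl _ r2.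
  move=> /near_vnorm[d1 d10 H]; exists (Num.min d1 (d / 4)).
    by rewrite lt_min d10 divr_gt0.
  split; first by rewrite ge_min lexx orbT.
  move=> w; rewrite lt_min => /andP[wd _]; apply: ltW.
  by have := H w; rewrite linear0 !subr0; apply.
have inball w (u : C) : vnorm w < d' -> normc u < 4 * r ->
    vnorm (z0 + w + (u - l w) *: v - z0) < d.
  move=> wd ur; have -> : z0 + w + (u - l w) *: v - z0 = w + (u - l w) *: v.
    by rewrite addrAC (addrC z0) addrK.
  apply: le_lt_trans (ler_vnormD _ _) _; rewrite vnormZ -/c.
  have t := ler_normcD u (- l w); rewrite normcN in t.
  have lw := lr w wd.
  have h1 : normc (u - l w) <= 9 / 2 * r by lra.
  have h2 : normc (u - l w) * c <= 9 / 2 * r * c by rewrite ler_wpM2r.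
  have h3 : 9 / 2 * r * c <= 9 / 2 * (d / 16) by rewrite -mulrA ler_wpM2l.
  lra.
have lw0 w : l (z0 + w) = l w by rewrite linearD lz0 add0r.
(* On the line through [z] of direction [v], parametrized by the value of [l],
   this is the restriction of [g] divided by [u (u - l z)]. *)
pose Phi (u : C) (z : V) := g (z + (u - l z) *: v) * (u^-1 * (u - l z)^-1).
have dline (z : V) (k u : C) : differentiable (fun u : C => z + (u - k) *: v) u.
  have -> : (fun u : C => z + (u - k) *: v) = (fun u : C => (z - k *: v) + u *: v).
    by apply/funext => u'; rewrite scalerBl addrA addrAC.
  exact: differentiable_line.
have dphi w (u : C) : vnorm w < d' -> normc u < 4 * r ->
    differentiable (fun u => g (z0 + w + (u - l w) *: v)) u.
  move=> wd ur; have [Oy _] := dP _ (inball w u wd ur).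
  exact: (@differentiable_comp _ _ _ _ (fun u : C => z0 + w + (u - l w) *: v) g
    u (dline _ _ _) (dg _ Oy)).
have dul (u : C) z : differentiable (fun z : V => u - l z) z.
  apply: (@differentiableB _ _ _ (cst u) l); first exact: differentiable_cst.
  exact: linear_differentiable_cV.
have p0 : 0 < 3 * r / 4 by rewrite divr_gt0 // mulr_gt0.
have dh : differentiable (fun z => cauchy_integral r (Phi^~ z)) z0.
  apply: (@differentiable_cauchy_integral _ _ Phi z0 r d'
    (1 * (4 / (3 * r) * (4 / r))) r0 d'0).
  - move=> u w ua wd; have /andP[u1 u2] := ua; have lw := lr w wd.
    have [Oy gy] := dP _ (inball w u wd u2).
    have p1 : 3 * r / 4 < normc u by rewrite mulrAC.
    split.
      apply: (@differentiableM _ _ (fun z => g (z + (u - l z) *: v))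
        (fun z => u^-1 * (u - l z)^-1)).
        apply: (@differentiable_comp _ _ _ _ (fun z : V => z + (u - l z) *: v) g).
          apply: (@differentiableD _ _ _ id (fun z : V => (u - l z) *: v)); first exact: ex_diff.
          by apply: (@differentiableZl _ _ _ (fun z : V => u - l z)); exact: dul.
        by apply: dg; rewrite lw0.
      apply: (@differentiableM _ _ (cst u^-1) (fun z => (u - l z)^-1)).
        exact: differentiable_cst.
      apply: (@differentiableV _ _ (fun z => u - l z)); first exact: dul.
      by rewrite lw0 subr_eq0 (annulus_neq r0 ua lw).
    rewrite /Phi lw0 normcM; apply: ler_pM; rewrite ?normc_ge0 //.
    rewrite normcM !normcV; apply: ler_pM; rewrite ?invr_ge0 ?normc_ge0 //.
      by rewrite -[leRHS]invf_div lef_pV2 ?posrE ?(ltW p1) ?(lt_trans p0 p1) // mulr_gt0.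
    have q := annulus_sub r0 ua lw; have q0 : 0 < r / 4 by rewrite divr_gt0.
    by rewrite -[leRHS]invf_div lef_pV2 ?posrE // (lt_le_trans q0).
  - move=> u w ua wd; have /andP[u1 u2] := ua; have lw := lr w wd.
    rewrite /Phi lw0; apply: continuous_mul_at.
      exact: differentiable_continuous (dphi w u wd u2).
    apply: continuous_mul_at; first exact/continuous_inv/(annulus_neq0 r0 ua).
    exact/continuous_inv_sub/(annulus_neq r0 ua lw).
apply: differentiable_near dh; apply/near_vnorm; exists d' => // z zd.
pose w := z - z0; have zE : z = z0 + w by rewrite addrC subrK.
have wd : vnorm w < d' by [].
have lz : l z = l w by rewrite zE lw0.
have lw := lr w wd; rewrite {}zE in lz *.
pose f (u : C) := g (z0 + w + (u - l w) *: v).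
have fP (u : C) : normc u < 4 * r -> differentiable f u /\ normc (f u) <= 1.
  by move=> ur; split; [exact: dphi|have [] := dP _ (inball w u wd ur)].
have df (u : C) : normc u < 4 * r -> differentiable f u by move=> /fP[].
have n0 : normc (0 : C) < 4 * r by rewrite normc0 mulr_gt0.
have f0 : f 0 = 0.
  apply: g0; first by have [] := dP _ (inball w 0 wd n0).
  have -> : l (z0 + w + (0 - l w) *: v) = l w + (0 - l w) * l v by rewrite linearD lw0 linearZ.
  by rewrite lv mulr1 sub0r subrr.
have cf u : annulus r u -> {for u, continuous f}.
  by move=> /andP[_ /df]; exact: differentiable_continuous.
have ci u : annulus r u -> {for u, continuous (fun z : C => z^-1)}.
  by move=> /(annulus_neq0 r0); exact: continuous_inv.
have ct u : annulus r u -> {for u, continuous (fun z : C => (z - l w)^-1)}.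
  by move=> ua; apply/continuous_inv_sub/(annulus_neq r0 ua lw).
have PhiE u : Phi u (z0 + w) = f u * (u^-1 * (u - l w)^-1) by rewrite /Phi lw0.
have zr : normc (0 : C) <= r / 2 by rewrite normc0 divr_ge0 // ltW.
rewrite /h lz; case: ifPn => [/eqP l0|l0].
  have fA e : 0 < e -> exists2 d : R, 0 < d & forall t, normc t < d ->
      normc (f t - f 0 - 'd g (z0 + w) v * t) <= e * normc t.
    move=> e0; have [Oz _] := dP _ (inball w 0 wd n0).
    rewrite l0 subrr scale0r addr0 in Oz.
    have [|d1 d10 H] := differentiable_vnorm (dg _ Oz) (e := e / (c + 1)).
      by rewrite divr_gt0.
    exists (d1 / (c + 1)); first by rewrite divr_gt0.
    move=> t td; have ntc : normc t * c <= normc t * (c + 1).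
      by rewrite ler_wpM2l ?normc_ge0 // lerDl.
    have tv : vnorm (t *: v) < d1.
      by rewrite vnormZ; apply: le_lt_trans ntc _; rewrite -ltr_pdivlMr.
    have := H _ tv; rewrite vnormZ.
    have -> : 'd g (z0 + w) (t *: v) = 'd g (z0 + w) v * t by rewrite linearZ mulrC.
    rewrite /f l0 !subr0 scale0r addr0 => /le_trans; apply.
    rewrite -mulrA ler_wpM2l ?(ltW e0) // mulrC ler_pdivrMr //.
  rewrite (cauchy_derivative r0 fP fA).
  by apply: (eq_cauchy_integral r0) => u _; rewrite PhiE l0 subr0 -invfM expr2.
have fl : f (l w) = g (z0 + w) by rewrite /f subrr scale0r addr0.
have cPhi u : annulus r u -> {for u, continuous (Phi^~ (z0 + w))}.
  move=> ua; have -> : Phi^~ (z0 + w) = fun u => f u * (u^-1 * (u - l w)^-1).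
    exact/funext.
  apply: continuous_mul_at; first exact: cf.
  by apply: continuous_mul_at; [exact: ci|exact: ct].
have c1' u : annulus r u -> {for u, continuous (fun u => f u * u^-1)}.
  by move=> ua; apply: continuous_mul_at; [exact: cf|exact: ci].
apply: (canRL (mulfK l0)); rewrite -fl mulrC (cauchy_integral_formula r0 df lw).
rewrite -[LHS]addr0 -{1}f0 (cauchy_integral_formula r0 df zr).
have -> : cauchy_integral r (fun z1 => f z1 / (z1 - 0)) = cauchy_integral r (fun u => f u * u^-1).
  by apply: (eq_cauchy_integral r0) => u _; rewrite subr0.
rewrite -(cauchy_integral_comb (l w) r0 cPhi c1').
apply: (eq_cauchy_integral r0) => u ua; rewrite PhiE; field.
by rewrite (annulus_neq0 r0 ua) subr_eq0 (annulus_neq r0 ua lw).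
Qed.
End Division.

(** * Homogeneous polynomial functions *)

Section Forms.
Context {K : fieldType} {n : nat}.
Local Notation V := 'cV[K]_n.
Implicit Types (f g : V -> K).

(** Homogeneous polynomials of degree [k], as functions.  The recursion on the
    degree makes most proofs independent of monomials and coefficients. *)
Fixpoint form k f : Prop :=
  if k is k'.+1 then
    exists2 g : 'I_n -> V -> K, (forall j, form k' (g j)) &
      f = (fun z => \sum_j z j 0 * g j z)
  else exists c, f = cst c.

Lemma form_comb k (a : K) f g : form k f -> form k g ->
  form k (fun z => a * f z + g z).
Proof.
elim: k f g => [|k IH] f g /=.
  by move=> [c ->] [d ->]; exists (a * c + d).
move=> [f' f'P ->] [g' g'P ->]; exists (fun j z => a * f' j z + g' j z).
  by move=> j; exact: IH.
apply/funext => z; rewrite mulr_sumr -big_split; apply: eq_bigr => j _ /=.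
by ring.
Qed.

Lemma form0 k : form k (fun=> 0).
Proof.
elim: k => [|k IH]; first by exists 0.
exists (fun _ _ => 0) => //; apply/funext => z.
by rewrite big1 // => j _; rewrite mulr0.
Qed.

Lemma formD k f g : form k f -> form k g -> form k (fun z => f z + g z).
Proof.
move=> ff fg; have -> : (fun z => f z + g z) = (fun z => 1 * f z + g z).
  by apply/funext => z; rewrite mul1r.
exact: form_comb.
Qed.

Lemma formZ k (a : K) f : form k f -> form k (fun z => a * f z).
Proof.
move=> ff; have -> : (fun z => a * f z) = (fun z => a * f z + 0).
  by apply/funext => z; rewrite addr0.
by apply: form_comb => //; exact: form0.
Qed.

Lemma form_sum k (I : Type) (r : seq I) (P : pred I) (F : I -> V -> K) :
  (forall i, P i -> form k (F i)) -> form k (fun z => \sum_(i <- r | P i) F i z).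
Proof.
move=> FP; elim: r => [|i r IH].
  have -> : (fun z => \sum_(i <- [::] | P i) F i z) = (fun=> 0).
    by apply/funext => z; rewrite big_nil.
  exact: form0.
have [Pi|nPi] := boolP (P i).
  have -> : (fun z => \sum_(i <- i :: r | P i) F i z) =
      (fun z => F i z + \sum_(i <- r | P i) F i z).
    by apply/funext => z; rewrite big_cons Pi.
  by apply: formD => //; exact: FP.
have -> : (fun z => \sum_(i <- i :: r | P i) F i z) =
    (fun z => \sum_(i <- r | P i) F i z).
  by apply/funext => z; rewrite big_cons (negPf nPi).
exact: IH.
Qed.

Lemma formM j k f g : form j f -> form k g -> form (j + k) (fun z => f z * g z).
Proof.
elim: j f => [|j IH] f /=; first by move=> [c ->] fg; exact: formZ.
move=> [f' f'P ->] fg; exists (fun i z => f' i z * g z).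
  by move=> i; exact: IH.
by apply/funext => z; rewrite mulr_suml; apply: eq_bigr => i _; rewrite mulrA.
Qed.

Lemma form_coord j : form 1 (fun z => z j 0).
Proof.
exists (fun i => cst (i == j)%:R); first by move=> i; exists (i == j)%:R.
apply/funext => z; rewrite (bigD1 j) //= eqxx mulr1 big1 ?addr0 // => i ij.
by rewrite (negPf ij) mulr0.
Qed.

Lemma form_linear (l : 'rV[K]_n) : form 1 (fun z => (l *m z) 0 0).
Proof.
have -> : (fun z : V => (l *m z) 0 0) = (fun z => \sum_j l 0 j * z j 0).
  by apply/funext => z; rewrite mxE.
by apply: form_sum => j _; apply: formZ; exact: form_coord.
Qed.

Lemma form_act k (rho : 'M[K]_n) f : form k f -> form k (fun z => f (rho *m z)).
Proof.
elim: k f => [|k IH] f /=; first by move=> [c ->]; exists c.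
move=> [g gP ->]; apply: (@form_sum k.+1) => j _.
apply: (@formM 1) => //; last exact: IH.
have -> : (fun z : V => (rho *m z) j 0) = (fun z => (row j rho *m z) 0 0).
  by apply/funext => z; rewrite -row_mul [RHS]mxE.
exact: form_linear.
Qed.

(** By induction on the degree, with the rule for the divided difference of the
    product [z j 0 * g j z]; that of a coordinate is a constant. *)
Lemma form_divided k (s : 'M[K]_n) (v : V) (l : 'rV[K]_n) f :
    1%:M - s = v *m l -> form k f ->
  exists2 g, (if k is k'.+1 then form k' g else g = fun=> 0) &
    forall z, f z - f (s *m z) = (l *m z) 0 0 * g z.
Proof.
move=> sE; have szE (z : V) i : z i 0 - (s *m z) i 0 = (l *m z) 0 0 * v i 0.
  have -> : z i 0 - (s *m z) i 0 = ((1%:M - s) *m z) i 0.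
    by rewrite mulmxBl mul1mx [RHS]mxE; congr (_ + _); rewrite [RHS]mxE.
  by rewrite sE -mulmxA mxE big_ord1 mulrC.
elim: k f => [|k IH] f.
  by move=> [c ->]; exists (fun=> 0) => // z; rewrite subrr mulr0.
move=> [g gP ->].
have /choice[g' g'P] : forall j, exists g',
    (if k is k'.+1 then form k' g' else g' = fun=> 0) /\
    forall z, g j z - g j (s *m z) = (l *m z) 0 0 * g' z.
  by move=> j; have [g' g'k g'E] := IH _ (gP j); exists g'; split; [exact: g'k|exact: g'E].
exists (fun z => \sum_j (v j 0 * g j z + (s *m z) j 0 * g' j z)).
  apply: form_sum => j _; apply: formD; first exact: formZ (gP j).
  have [g'k _] := g'P j; case: k {IH gP g'P} g'k => [->|k fk].
    have -> : (fun z : V => (s *m z) j 0 * 0) = (fun=> 0).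
      by apply/funext => z; rewrite mulr0.
    exact: form0.
  apply: (@formM 1) => //; exact: (form_act s (form_coord j)).
move=> z; rewrite -sumrB mulr_sumr; apply: eq_bigr => j _.
have [_ E] := g'P j; have Ez := szE z j.
transitivity ((l *m z) 0 0 * v j 0 * g j z +
  (s *m z) j 0 * ((l *m z) 0 0 * g' j z)); last by ring.
by rewrite -(E z) -Ez; ring.
Qed.

End Forms.

(** * Monomials and invariant forms *)

Section Monomials.
Context {K : fieldType} {n : nat}.
Local Notation V := 'cV[K]_n.
Implicit Types (f g : V -> K) (a : 'I_n -> nat).

Definition monomial a : V -> K := fun z => \prod_j z j 0 ^+ a j.

Lemma form_exp j k f : form j f -> form (k * j) (fun z => f z ^+ k).
Proof.
move=> ff; elim: k => [|k IH].
  have -> : (fun z => f z ^+ 0) = cst 1 by apply/funext => z; rewrite expr0.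
  by exists 1.
have -> : (fun z => f z ^+ k.+1) = (fun z => f z * f z ^+ k).
  by apply/funext => z; rewrite exprS.
by rewrite mulSn; exact: formM.
Qed.

Lemma monomial_form a : form (\sum_j a j) (monomial a).
Proof.
rewrite /monomial; elim: (index_enum 'I_n) => [|j r IH].
  rewrite big_nil.
  have -> : (fun z : V => \prod_(j <- [::]) z j 0 ^+ a j) = cst 1.
    by apply/funext => z; rewrite big_nil.
  by exists 1.
rewrite big_cons.
have -> : (fun z : V => \prod_(j <- j :: r) z j 0 ^+ a j) =
    (fun z => z j 0 ^+ a j * \prod_(j <- r) z j 0 ^+ a j).
  by apply/funext => z; rewrite big_cons.
apply: formM => //; rewrite -[X in form X]muln1; exact: (form_exp _ (form_coord j)).
Qed.

Lemma monomialD a b z : monomial (fun j => a j + b j)%N z = monomial a z * monomial b z.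
Proof. by rewrite -big_split; apply: eq_bigr => j _; rewrite exprD. Qed.

Lemma monomial_pow j (k : nat) z :
  monomial (fun i => if i == j then k else 0%N) z = z j 0 ^+ k.
Proof.
rewrite /monomial (bigD1 j) //= eqxx big1 ?mulr1 // => i ij.
by rewrite (negPf ij).
Qed.

Definition closed_comb (P : (V -> K) -> Prop) :=
  P (fun=> 0) /\ forall c f g, P f -> P g -> P (fun z => c * f z + g z).

Lemma closed_comb_sum P (I : eqType) (r : seq I) (F : I -> V -> K) :
  closed_comb P -> {in r, forall i, P (F i)} -> P (fun z => \sum_(i <- r) F i z).
Proof.
move=> [P0 Pc]; elim: r => [|i r IH] PF.
  have -> : (fun z => \sum_(i <- [::]) F i z) = (fun=> 0).
    by apply/funext => z; rewrite big_nil.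
  exact: P0.
have -> : (fun z => \sum_(i <- i :: r) F i z) =
    (fun z => 1 * F i z + \sum_(i <- r) F i z).
  by apply/funext => z; rewrite big_cons mul1r.
apply: Pc; first by apply: PF; exact: mem_head.
by apply: IH => j jr; apply: PF; rewrite in_cons jr orbT.
Qed.

(** That monomials span the forms, as an induction principle: it is used for
    the subspaces [hilbert_ideal] and [generated], without any coefficients. *)
Lemma monomial_span k (P : (V -> K) -> Prop) : closed_comb P ->
    (forall a, \sum_j a j = k -> P (monomial a))%N ->
  forall f, form k f -> P f.
Proof.
elim: k P => [|k IH] P Pcl Pm f /=.
  move=> [c ->]; have [P0 Pc] := Pcl.
  have -> : cst c = (fun z => c * monomial (fun=> 0%N) z + 0).
    apply/funext => z; rewrite /monomial big1 ?mulr1 ?addr0 // => j _.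
  by apply: Pc => //; apply: Pm; rewrite big1.
move=> [g gP ->]; apply: closed_comb_sum => // j _.
have [P0 Pc] := Pcl.
apply: (IH (fun g => P (fun z => z j 0 * g z))); last exact: gP.
  split.
    have -> : (fun z : V => z j 0 * 0) = (fun=> 0) by apply/funext => z; rewrite mulr0.
    exact: P0.
  move=> c u w Pu Pw.
  have -> : (fun z : V => z j 0 * (c * u z + w z)) =
      (fun z : V => c * (z j 0 * u z) + z j 0 * w z) by apply/funext => z; ring.
  exact: Pc.
move=> a ak.
have -> : (fun z : V => z j 0 * monomial a z) =
    monomial (fun i => (if i == j then 1 else 0) + a i)%N.
  by apply/funext => z; rewrite monomialD monomial_pow expr1.
apply: Pm; rewrite big_split /= ak -big_mkcond /= big_pred1_eq.
by [].
Qed.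

End Monomials.

Section Invariants.
Context {K : numFieldType} {n : nat}.
Local Notation V := 'cV[K]_n.
Variables (G : set 'M[K]_n) (gs : seq 'M[K]_n).
Hypotheses (lG : linear_group G) (gs_uniq : uniq gs).
Hypothesis gsP : forall rho, rho \in gs <-> G rho.
Implicit Types (f g r h : V -> K) (rho sigma : 'M[K]_n).

Definition invariant r := forall rho, G rho -> forall z, r (rho *m z) = r z.

Lemma perm_mulr sigma : G sigma -> perm_eq [seq rho *m sigma | rho <- gs] gs.
Proof.
have [Gu G1 GM GV] := lG; move=> Gs; apply: uniq_perm => //.
  by rewrite map_inj_uniq //; apply: can_inj (mulmxK (Gu _ Gs)).
move=> rho; apply/mapP/idP => [[tau /gsP Gt ->]|/gsP Gr].
  by apply/gsP; exact: GM.
exists (rho *m invmx sigma); last by rewrite mulmxKV // Gu.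
by apply/gsP; apply: GM => //; exact: GV.
Qed.

Lemma size_gs_neq0 : (size gs)%:R != 0 :> K.
Proof.
have [_ G1 _ _] := lG; rewrite pnatr_eq0 size_eq0.
by apply: contraTneq ((gsP _).2 G1) => ->.
Qed.

Definition average f : V -> K :=
  fun z => (size gs)%:R^-1 * \sum_(rho <- gs) f (rho *m z).

Lemma average_invariant f : invariant (average f).
Proof.
move=> sigma Gs z; rewrite /average; congr (_ * _).
rewrite -[RHS](perm_big _ (perm_mulr Gs)) big_map.
by apply: eq_bigr => rho _; rewrite mulmxA.
Qed.

Lemma average_form k f : form k f -> form k (average f).
Proof.
by move=> ff; apply: formZ; apply: form_sum => rho _; exact: form_act.
Qed.

(** The component of degree [k] of the ideal generated by the invariant forms
    of positive degree. *)
Inductive hilbert_ideal k : (V -> K) -> Prop :=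
| hilbert_ideal0 : hilbert_ideal k (fun=> 0)
| hilbert_idealA e j r h g : (0 < e)%N -> (e + j)%N = k -> form e r -> invariant r ->
    form j h -> hilbert_ideal k g -> hilbert_ideal k (fun z => r z * h z + g z).

Lemma hilbert_ideal_comb k c f g : hilbert_ideal k f -> hilbert_ideal k g ->
  hilbert_ideal k (fun z => c * f z + g z).
Proof.
move=> + Hg; elim=> [|e j r h f' e0 ejk er ir jh _ IH].
  have -> : (fun z => c * 0 + g z) = g by apply/funext => z; rewrite mulr0 add0r.
  exact: Hg.
have -> : (fun z => c * (r z * h z + f' z) + g z) =
  (fun z => r z * (c * h z) + (c * f' z + g z)) by apply/funext => z; ring.
by apply: (hilbert_idealA e0 ejk er ir) => //; exact: formZ.
Qed.

Lemma hilbert_ideal_closed k : closed_comb (hilbert_ideal k).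
Proof. by split; [exact: hilbert_ideal0|move=> c f g; exact: hilbert_ideal_comb]. Qed.

Lemma hilbert_idealM j k f h : form j h -> hilbert_ideal k f ->
  hilbert_ideal (j + k) (fun z => h z * f z).
Proof.
move=> jh; elim=> [|e i r h' f' e0 eik er ir ih _ IH].
  have -> : (fun z => h z * 0) = (fun=> 0) by apply/funext => z; rewrite mulr0.
  exact: hilbert_ideal0.
have -> : (fun z => h z * (r z * h' z + f' z)) =
  (fun z => r z * (h z * h' z) + h z * f' z) by apply/funext => z; ring.
apply: (hilbert_idealA e0 _ er ir (formM jh ih)) => //.
by rewrite addnCA eik.
Qed.

Lemma hilbert_ideal_act k f rho : G rho -> hilbert_ideal k f ->
  hilbert_ideal k (fun z => f (rho *m z)).
Proof.
move=> Gr; elim=> [|e i r h' f' e0 eik er ir ih _ IH]; first exact: hilbert_ideal0.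
have -> : (fun z => r (rho *m z) * h' (rho *m z) + f' (rho *m z)) =
  (fun z => r z * h' (rho *m z) + f' (rho *m z)).
  by apply/funext => z; rewrite ir.
by apply: (hilbert_idealA e0 eik er ir) => //; exact: form_act.
Qed.

Lemma hilbert_ideal_gen e j r h : (0 < e)%N -> form e r -> invariant r -> form j h ->
  hilbert_ideal (e + j) (fun z => r z * h z).
Proof.
move=> e0 er ir jh; have -> : (fun z => r z * h z) = (fun z => r z * h z + 0).
  by apply/funext => z; rewrite addr0.
by apply: (hilbert_idealA e0 _ er ir jh) => //; exact: hilbert_ideal0.
Qed.

(** Up to sign, these coefficients are the elementary symmetric functions of
    the translates of [f]. *)
Lemma form_orbit_coef f (s : seq 'M[K]_n) m : form 1 f -> (m <= size s)%N ->
  form (size s - m) (fun z => (\prod_(rho <- s) ('X - (f (rho *m z))%:P))`_m).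
Proof.
move=> ff; elim: s m => [|sigma s IH] m /=.
  rewrite leqn0 => /eqP->.
  have -> : (fun z : V => (\prod_(rho <- [::]) ('X - (f (rho *m z))%:P))`_0) = cst 1.
    by apply/funext => z; rewrite big_nil coef1.
  by exists 1.
pose Q m z := (\prod_(rho <- s) ('X - (f (rho *m z))%:P))`_m.
case: m => [|m] ms.
  have -> : (fun z : V => (\prod_(rho <- sigma :: s) ('X - (f (rho *m z))%:P))`_0) =
      (fun z => -1 * (f (sigma *m z) * Q 0%N z)).
    apply/funext => z; rewrite big_cons mulrBl coefB coefXM coefCM /= sub0r.
    by rewrite mulN1r.
  rewrite subn0; apply: formZ; apply: (@formM _ _ 1 (size s)); first exact: form_act.
  by have := IH 0%N (leq0n _); rewrite subn0.
have -> : (fun z : V => (\prod_(rho <- sigma :: s) ('X - (f (rho *m z))%:P))`_m.+1) =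
    (fun z => -1 * (f (sigma *m z) * Q m.+1 z) + Q m z).
  apply/funext => z; rewrite big_cons mulrBl coefB coefXM coefCM /=.
  by rewrite mulN1r addrC.
rewrite subSS; apply: form_comb; last exact: IH.
have [lt|ge] := ltnP m (size s).
  rewrite -(subnSK lt); apply: (@formM _ _ 1); first exact: form_act.
  exact: IH.
have -> : (fun z => f (sigma *m z) * Q m.+1 z) = (fun=> 0).
  apply/funext => z; rewrite /Q nth_default ?mulr0 //.
  by rewrite (size_prod_XsubC s (fun rho => f (rho *m z))).
exact: form0.
Qed.

(** [f] is a root of the product of the ['X - f o rho], whose coefficients other
    than the leading one are invariant forms of positive degree. *)
Lemma hilbert_ideal_pow f : form 1 f ->
  hilbert_ideal (size gs) (fun z => f z ^+ size gs).
Proof.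
move=> ff; pose P z := \prod_(rho <- gs) ('X - (f (rho *m z))%:P).
have szP z : size (P z) = (size gs).+1.
  exact: (size_prod_XsubC gs (fun rho => f (rho *m z))).
have -> : (fun z => f z ^+ size gs) =
    (fun z => \sum_(m < size gs) ((P z)`_m * (-1 * f z ^+ m))).
  apply/funext => z.
  have : (P z).[f z] = 0.
    have [_ G1 _ _] := lG; rewrite horner_prod (big_rem 1%:M) ?(gsP 1%:M).2 //=.
    by rewrite hornerXsubC mul1mx subrr mul0r.
  rewrite horner_coef szP big_ord_recr /=.
  have -> : (P z)`_(size gs) = 1.
    have /monicP := monic_prod_XsubC gs (fun=> true) (fun rho => f (rho *m z)).
    by rewrite lead_coefE szP.
  rewrite mul1r => /eqP; rewrite addrC addr_eq0 => /eqP->.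
  by rewrite -sumrN; apply: eq_bigr => i _; ring.
apply: closed_comb_sum; first exact: hilbert_ideal_closed.
move=> m _.
rewrite -[X in hilbert_ideal X](subnK (ltnW (ltn_ord m))).
apply: hilbert_ideal_gen.
- by rewrite subn_gt0.
- apply: form_orbit_coef => //; exact: ltnW.
- move=> sigma Gs z; suff -> : P (sigma *m z) = P z by [].
  rewrite /P -[RHS](perm_big _ (perm_mulr Gs)) big_map.
  by apply: eq_bigr => rho _; rewrite mulmxA.
- by apply: formZ; rewrite -[X in form X]muln1; exact: form_exp.
Qed.

(** A monomial of large degree is divisible by the power [size gs] of some
    coordinate. *)
Lemma hilbert_ideal_large k f : (n * (size gs).-1 < k)%N -> form k f -> hilbert_ideal k f.
Proof.
move=> nk; apply: monomial_span; first exact: hilbert_ideal_closed.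
move=> a ak; have [j ja] : exists j, (size gs <= a j)%N.
  apply: contrapT => nj; move: nk; rewrite -ak ltnNge => /negP; apply.
  rewrite -[X in (X * _)%N]card_ord -sum_nat_const; apply: leq_sum => j _.
  rewrite -ltnS; case: (ltnP (a j) (size gs)) => [lt|ge]; last by case: nj; exists j.
  exact: leq_trans lt (leqSpred _).
pose b i := (a i - (if i == j then size gs else 0))%N.
have aE i : a i = ((if i == j then size gs else 0) + b i)%N.
  by rewrite /b; case: eqP => [->|_]; rewrite ?subnKC ?subn0.
have -> : monomial a = (fun z : V => monomial b z * z j 0 ^+ size gs).
  apply/funext => z; rewrite mulrC -monomial_pow -monomialD.
  by apply: eq_bigr => i _; rewrite -aE.
have -> : k = (\sum_i b i + size gs)%N.
  rewrite -ak (eq_bigr _ (fun i _ => aE i)) big_split /= -big_mkcond /=.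
  by rewrite big_pred1_eq addnC.
by apply: hilbert_idealM; [exact: monomial_form|exact/hilbert_ideal_pow/form_coord].
Qed.

End Invariants.

(** * Operators built from divided differences *)

Lemma rank1_mulmx (K : fieldType) m n (A : 'M[K]_(m, n)) : \rank A = 1%N ->
  exists v : 'cV[K]_m, exists2 l : 'rV[K]_n, A = v *m l & l != 0.
Proof.
move=> rA; have A0 : A != 0 by rewrite -mxrank_eq0 rA.
move: (col_base A) (row_base A) (mulmx_base A); rewrite rA => v l vl.
exists v, l => //; apply: contra_neq A0 => l0.
by rewrite -vl l0 mulmx0.
Qed.

(** [S] generates [G], which is listed by [gs].  [A] stands for the space of
    functions to study on the [G]-invariant set [Omega]: it contains the
    polynomials and it is stable under divided differences. *)
Section Operators.
Context {K : numFieldType} {n : nat}.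
Local Notation V := 'cV[K]_n.
Variables (G S : set 'M[K]_n) (gs : seq 'M[K]_n).
Hypotheses (lG : linear_group G) (gs_uniq : uniq gs).
Hypothesis gsP : forall rho, rho \in gs <-> G rho.
Hypotheses (SG : S `<=` G) (S_pseudo : S `<=` pseudoreflection).
Hypothesis S_gen : forall H : set 'M[K]_n, linear_group H -> S `<=` H -> G `<=` H.
Variables (Omega : set V) (A : (V -> K) -> Prop).
Hypothesis Omega_act : forall rho z, G rho -> Omega z -> Omega (rho *m z).
Hypothesis A_form : forall k f, form k f -> A f.
Hypothesis A_add : forall f g, A f -> A g -> A (fun z => f z + g z).
Hypothesis A_mul : forall f g, A f -> A g -> A (fun z => f z * g z).
Hypothesis A_divided : forall s v (l : 'rV[K]_n) f, G s -> 1%:M - s = v *m l ->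
  l != 0 -> A f ->
  exists2 g, A g & forall z, Omega z -> f z - f (s *m z) = (l *m z) 0 0 * g z.
Implicit Types (f g h : V -> K) (T : (V -> K) -> V -> K) (rho : 'M[K]_n).

Definition regular_point (z : V) := forall rho, G rho -> rho *m z = z -> rho = 1%:M.

Lemma regular_act z rho : G rho -> regular_point z -> regular_point (rho *m z).
Proof.
have [Gu G1 GM GV] := lG; move=> Gr zr sigma Gs /(congr1 (mulmx (invmx rho))).
rewrite !mulmxA mulVmx ?Gu // mul1mx => E.
have GG : G (invmx rho *m sigma *m rho) by apply: (GM) => //; apply: (GM) => //; exact: GV.
have := zr _ GG; rewrite E => /(_ erefl) /(congr1 (fun M => rho *m M *m invmx rho)).
by rewrite !mulmxA mulmxK ?Gu // mulmxV ?Gu // mul1mx mulmx1 mulmxV ?Gu.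
Qed.

(** With [a = 0] and [f] arbitrary, the equation says that [T h z] only depends
    on the values of [h] on the orbit of [z]. *)
Definition orbit_linear T := forall z, regular_point z -> forall a f g h,
  (forall rho, G rho -> h (rho *m z) = a * f (rho *m z) + g (rho *m z)) ->
  T h z = a * T f z + T g z.

Definition lowers k T := forall m f, form m f ->
  exists2 g, (if (k <= m)%N then form (m - k) g else g = fun=> 0) &
    forall z, regular_point z -> T f z = g z.

Definition preserves T := forall f, A f -> exists2 g, A g &
  forall z, Omega z -> regular_point z -> T f z = g z.

Definition admissible k T := [/\ orbit_linear T, lowers k T & preserves T].

Lemma orbit_linear0 T z h : orbit_linear T -> regular_point z ->
  (forall rho, G rho -> h (rho *m z) = 0) -> T h z = 0.
Proof.
move=> Tl zr h0; rewrite (Tl z zr (-1) h h h) ?mulN1r ?addNr //.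
by move=> rho Gr; rewrite mulN1r addNr h0.
Qed.

Lemma orbit_local T z f g : orbit_linear T -> regular_point z ->
  (forall rho, G rho -> f (rho *m z) = g (rho *m z)) -> T f z = T g z.
Proof.
move=> Tl zr fg; rewrite (Tl z zr 0 f g f) ?mul0r ?add0r //.
by move=> rho Gr; rewrite mul0r add0r fg.
Qed.

Lemma orbit_linear_sum T z (I : Type) (r : seq I) (a : I -> K) (F : I -> V -> K) h :
    orbit_linear T -> regular_point z ->
    (forall rho, G rho -> h (rho *m z) = \sum_(i <- r) a i * F i (rho *m z)) ->
  T h z = \sum_(i <- r) a i * T (F i) z.
Proof.
move=> Tl zr; elim: r h => [|i r IH] h hE.
  by rewrite big_nil; apply: orbit_linear0 => // rho /hE; rewrite big_nil.
rewrite big_cons -(IH (fun z => \sum_(i <- r) a i * F i z)) //.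
by apply: Tl => // rho /hE; rewrite big_cons.
Qed.

Lemma admissible_scale c : admissible 0 (fun f z => c * f z).
Proof.
have [_ G1 _ _] := lG; split.
- move=> z _ a f g h H; have := H _ G1; rewrite mul1mx => ->; ring.
- by move=> m f ff; exists (fun z => c * f z) => //; rewrite subn0; exact: formZ.
- move=> f Af; exists (fun z => c * f z) => //.
  by apply: A_mul => //; apply: (@A_form 0); exists c.
Qed.

Lemma admissible_comb j k q T T' :
  admissible k T -> form j q -> admissible (j + k) T' ->
  admissible k (fun f z => T f z + q z * T' f z).
Proof.
move=> [Tl Tk TA] jq [T'l T'k T'A]; split.
- by move=> z zr a f g h H; rewrite (Tl z zr a f g h H) (T'l z zr a f g h H); ring.
- move=> m f ff; have [g gm gE] := Tk m f ff; have [g' g'm g'E] := T'k m f ff.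
  exists (fun z => g z + q z * g' z); last by move=> z zr; rewrite gE // g'E.
  case: (leqP k m) gm g'm => km gm.
    case: (leqP (j + k) m) => jkm g'm.
      apply: formD => //.
      have E : (j + (m - (j + k)) = m - k)%N.
        by rewrite (addnC j k) subnDA subnKC // leq_subRL // addnC.
      by rewrite -E; exact: formM.
    rewrite g'm; have -> : (fun z => g z + q z * 0) = g; last exact: gm.
    by apply/funext => z; rewrite mulr0 addr0.
  rewrite leqNgt (leq_trans km) ?leq_addl //= => ->.
  by rewrite gm; apply/funext => z; rewrite mulr0 addr0.
- move=> f Af; have [g Ag gE] := TA f Af; have [g' Ag' g'E] := T'A f Af.
  exists (fun z => g z + q z * g' z); last by move=> z Oz zr; rewrite gE // g'E.
  by apply: A_add => //; apply: A_mul => //; exact: A_form jq.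
Qed.

Lemma admissible_sum k T (I : Type) (r : seq I) (P : pred I) (c : I -> K)
    (F : I -> (V -> K) -> V -> K) :
    admissible k T -> (forall i, P i -> admissible k (F i)) ->
  admissible k (fun f z => T f z + \sum_(i <- r | P i) c i * F i f z).
Proof.
move=> Tk FP; elim: r => [|i r IH].
  have -> : (fun f z => T f z + \sum_(i <- [::] | P i) c i * F i f z) = T.
    by apply/funext => f; apply/funext => z; rewrite big_nil addr0.
  exact: Tk.
have [Pi|nPi] := boolP (P i); last first.
  have -> : (fun f z => T f z + \sum_(i <- i :: r | P i) c i * F i f z) =
      (fun f z => T f z + \sum_(i <- r | P i) c i * F i f z).
    by apply/funext => f; apply/funext => z; rewrite big_cons (negPf nPi).
  exact: IH.
have -> : (fun f z => T f z + \sum_(i <- i :: r | P i) c i * F i f z) =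
    (fun f z => (T f z + \sum_(i <- r | P i) c i * F i f z) + cst (c i) z * F i f z).
  by apply/funext => f; apply/funext => z; rewrite big_cons Pi addrAC -addrA.
by apply: (@admissible_comb 0) => //; [exists (c i)|exact: FP].
Qed.

Lemma reflection_regular s v (l : 'rV[K]_n) z : S s -> 1%:M - s = v *m l ->
  regular_point z -> (l *m z) 0 0 != 0.
Proof.
move=> Ss sE zr; apply/eqP => lz.
have s1 : s = 1%:M.
  apply: zr; first exact: SG.
  apply/eqP; rewrite eq_sym -subr_eq0 -[X in X - _]mul1mx -mulmxBl sE -mulmxA.
  by rewrite (_ : l *m z = 0) ?mulmx0 //; apply/matrixP => i j; rewrite !ord1 lz mxE.
by have [_ _] := S_pseudo Ss; rewrite s1 subrr mxrank0.
Qed.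

Lemma admissible_divided k T s v (l : 'rV[K]_n) : S s -> 1%:M - s = v *m l -> l != 0 ->
  admissible k T ->
  admissible k.+1 (fun f => T (fun z => (f z - f (s *m z)) / (l *m z) 0 0)).
Proof.
have [Gu G1 GM GV] := lG; move=> Ss sE l0 [Tl Tk TA].
have orb f g z : regular_point z ->
    (forall rho, G rho -> f (rho *m z) - f (s *m (rho *m z)) =
       (l *m (rho *m z)) 0 0 * g (rho *m z)) ->
    T (fun z => (f z - f (s *m z)) / (l *m z) 0 0) z = T g z.
  move=> zr fg; apply: orbit_local => // rho Gr; rewrite fg // mulrC mulKf //.
  exact: (reflection_regular Ss sE (regular_act Gr zr)).
split.
- move=> z zr a f g h H; apply: Tl => // rho Gr; rewrite H // mulmxA H; last first.
    by apply: GM => //; exact: SG.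
  by ring.
- move=> m f ff; have [g gm gE] := form_divided sE ff.
  case: m ff gm => [|m] ff gm.
    exists (fun=> 0) => // z zr; rewrite (orb f g) // gm.
    exact: orbit_linear0.
  have [g' g'm g'E] := Tk m g gm; exists g'; first by rewrite ltnS subSS.
  by move=> z zr; rewrite (orb f g) // g'E.
- move=> f Af; have [g Ag gE] := A_divided (SG Ss) sE l0 Af.
  have [g' Ag' g'E] := TA g Ag; exists g' => // z Oz zr.
  by rewrite (orb f g) ?g'E // => rho Gr; rewrite gE //; exact: Omega_act.
Qed.

(** This is where [G] being generated by pseudoreflections matters.  If no
    divided difference of [x] is outside the ideal, then [x - x o rho] is in the
    ideal for [rho] in [S], hence for all [rho] in [G]; and the average of [x]
    is in the ideal because its degree is positive. *)
Lemma coinvariant_separation k x : form k x -> ~ hilbert_ideal G k x ->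
  exists2 T, admissible k T & forall z, regular_point z -> T x z = 1.
Proof.
have [Gu G1 GM GV] := lG.
elim: k x => [|k IH] x.
  move=> [c ->] nx; have c0 : c != 0.
    by apply/eqP => c0; apply: nx; rewrite c0; exact: hilbert_ideal0.
  exists (fun f z => c^-1 * f z); first exact: admissible_scale.
  by move=> z _; rewrite /= mulVf.
move=> fx nx.
suff [s [v [l [g [Ss sE l0 gk [gE ng]]]]]] : exists s v (l : 'rV[K]_n) g,
    [/\ S s, 1%:M - s = v *m l, l != 0, form k g &
    (forall z, x z - x (s *m z) = (l *m z) 0 0 * g z) /\ ~ hilbert_ideal G k g].
  have [T Tk Tg] := IH g gk ng.
  exists (fun f => T (fun z => (f z - f (s *m z)) / (l *m z) 0 0)).
    exact: admissible_divided Ss sE l0 Tk.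
  move=> z zr; rewrite -(Tg z zr); have [Tl _ _] := Tk.
  apply: orbit_local => // rho Gr; rewrite gE mulrC mulKf //.
  exact: (reflection_regular Ss sE (regular_act Gr zr)).
apply: contrapT => no; apply: nx.
pose d rho : V -> K := fun z => x z - x (rho *m z).
have Sd s : S s -> hilbert_ideal G k.+1 (d s).
  move=> Ss; have [_ _ /rank1_mulmx[v [l sE l0]]] := S_pseudo Ss.
  have [g gk gE] := form_divided sE fx.
  have -> : d s = fun z => (l *m z) 0 0 * g z by apply/funext.
  apply: (@hilbert_idealM _ _ _ 1); first exact: form_linear.
  by apply: contrapT => ng; apply: no; exists s, v, l, g.
have Gd rho : G rho -> hilbert_ideal G k.+1 (d rho).
  pose H : set 'M[K]_n := [set rho | G rho /\ hilbert_ideal G k.+1 (d rho)].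
  suff /(_ rho) GH : G `<=` H by move=> /GH[].
  apply: S_gen; last by move=> s Ss; split; [exact: SG|exact: Sd].
  split=> [rho' [/Gu]//| |r1 r2 [G_1 H1] [G_2 H2]|r1 [G_1 H1]].
  - split=> //; have -> : d 1%:M = fun=> 0 by apply/funext => z; rewrite /d mul1mx subrr.
    exact: hilbert_ideal0.
  - split; first exact: GM.
    have -> : d (r1 *m r2) = fun z => 1 * d r1 (r2 *m z) + d r2 z.
      by apply/funext => z; rewrite /d mulmxA; ring.
    by apply: hilbert_ideal_comb => //; exact: hilbert_ideal_act.
  - split; first exact: GV.
    have -> : d (invmx r1) = fun z => -1 * d r1 (invmx r1 *m z) + 0.
      by apply/funext => z; rewrite /d mulmxA mulmxV ?Gu // mul1mx; ring.
    apply: hilbert_ideal_comb; last exact: hilbert_ideal0.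
    by apply: hilbert_ideal_act => //; exact: GV.
have -> : x = fun z => (size gs)%:R^-1 * (\sum_(rho <- gs) d rho z) + average gs x z * 1.
  apply/funext => z; rewrite mulr1 -mulrDr -big_split /=.
  under eq_bigr do rewrite subrK.
  rewrite big_const_seq count_predT iter_addr_0.
  rewrite -[x z *+ _]mulr_natl mulKf //.
  exact: size_gs_neq0 lG gsP.
apply: hilbert_ideal_comb.
  by apply: closed_comb_sum; [exact: hilbert_ideal_closed|move=> rho /gsP; exact: Gd].
rewrite -[k.+1]addn0; apply: hilbert_ideal_gen => //; last by exists 1.
  exact: average_form.
exact: average_invariant.
Qed.


Definition generated d (p : 'I_d -> V -> K) f :=
  exists2 r : 'I_d -> V -> K, (forall i, invariant G (r i)) &
    forall z, f z = \sum_i r i z * p i z.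

(** The [p i] and the [T i] are dual to each other exactly, not only modulo
    forms of positive degree. *)
Definition dual_system d (k : 'I_d -> nat) (p : 'I_d -> V -> K)
    (T : 'I_d -> (V -> K) -> V -> K) :=
  [/\ forall i, form (k i) (p i), forall i, admissible (k i) (T i) &
    forall i j z, regular_point z -> T i (p j) z = (i == j)%:R].

Lemma generated_closed d (p : 'I_d -> V -> K) : closed_comb (generated p).
Proof.
split=> [|c f g [r ri rE] [r' r'i r'E]].
  exists (fun _ _ => 0) => // z; rewrite big1 // => i _; exact: mul0r.
exists (fun i z => c * r i z + r' i z).
  by move=> i rho Gr z; rewrite (ri i rho Gr) (r'i i rho Gr).
move=> z; rewrite rE r'E mulr_sumr -big_split; apply: eq_bigr => i _ /=; ring.
Qed.

Lemma generated_basis d (p : 'I_d -> V -> K) i : generated p (p i).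
Proof.
exists (fun j _ => (j == i)%:R) => // z.
by rewrite (bigD1 i) //= eqxx mul1r big1 ?addr0 // => j /negPf->; rewrite mul0r.
Qed.

Lemma generatedM d (p : 'I_d -> V -> K) r f : invariant G r -> generated p f ->
  generated p (fun z => r z * f z).
Proof.
move=> ri [r' r'i r'E]; exists (fun i z => r z * r' i z).
  by move=> i rho Gr z; rewrite (ri rho Gr) (r'i i rho Gr).
by move=> z; rewrite r'E mulr_sumr; apply: eq_bigr => i _; rewrite mulrA.
Qed.

Lemma generated_trans d d' (p : 'I_d -> V -> K) (p' : 'I_d' -> V -> K) f :
  (forall i, generated p' (p i)) -> generated p f -> generated p' f.
Proof.
move=> pp' [r ri rE]; have -> : f = fun z => \sum_i r i z * p i z by exact/funext.
apply: (closed_comb_sum (F := fun i z => r i z * p i z) (generated_closed p')).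
by move=> i _; apply: generatedM.
Qed.

Lemma hilbert_ideal_generated d (p : 'I_d -> V -> K) k f :
    (forall j g, (j < k)%N -> form j g -> generated p g) ->
  hilbert_ideal G k f -> generated p f.
Proof.
move=> pk; elim=> [|e j r h g e0 ejk _ ri jh _ IH].
  by have [] := generated_closed p.
have [_ Pc] := generated_closed p.
have -> : (fun z => r z * h z + g z) = (fun z => 1 * (r z * h z) + g z).
  by apply/funext => z; rewrite mul1r.
apply: Pc => //; apply: generatedM => //; apply: pk jh.
by rewrite -ejk -[X in (X < _)%N]add0n ltn_add2r.
Qed.

(** A Gram-Schmidt step.  Let [x'] be [x] minus its components on the [p i] of
    the same degree [m].  If [x'] is in the ideal, it is generated by forms of
    lower degree.  Otherwise some operator [D] maps [x'] to [1]; it is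
    corrected so as to vanish on the [p i], and then the [T i] are corrected so
    as to vanish on [x']. *)
Lemma dual_system_extend d (k : 'I_d -> nat) (p : 'I_d -> V -> K)
    (T : 'I_d -> (V -> K) -> V -> K) m x :
    dual_system k p T -> (forall i, k i <= m)%N ->
    (forall j g, (j < m)%N -> form j g -> generated p g) -> form m x ->
  exists d' (k' : 'I_d' -> nat) (p' : 'I_d' -> V -> K)
    (T' : 'I_d' -> (V -> K) -> V -> K), [/\ dual_system k' p' T',
    forall i, (k' i <= m)%N, forall i, generated p' (p i) & generated p' x].
Proof.
move=> [pk Tk Tp] km pm xm.
have /choice[c cE] : forall i, exists c : K, (k i == m) ->
    forall z, regular_point z -> T i x z = c.
  move=> i; have [/eqP kim|_] := boolP (k i == m); last by exists 0.
  have [_ Tl _] := Tk i; have [g + gE] := Tl m x xm.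
  rewrite kim leqnn subnn => -[c gc]; exists c => _ z zr.
  by rewrite gE // gc.
pose x' : V -> K := fun z => x z + \sum_(i | k i == m) - c i * p i z.
have x'm : form m x'.
  apply: formD => //; apply: form_sum => i /eqP <-; exact: formZ.
have x'E : x = fun z => 1 * x' z + \sum_i (if k i == m then c i else 0) * p i z.
  apply/funext => z; rewrite mul1r /x' -addrA [X in _ + (X + _)]big_mkcond -big_split /=.
  rewrite big1 ?addr0 // => i _; case: ifP => _; ring.
have [hx'|nx'] := pselect (hilbert_ideal G m x').
  exists d, k, p, T; split=> //; first by move=> i; exact: generated_basis.
  have gx' := hilbert_ideal_generated pm hx'.
  have [_ Pc] := generated_closed p; rewrite x'E; apply: Pc => //.
  exists (fun i _ => if k i == m then c i else 0) => //.
have [D [Dl Dk DA] Dx'] := coinvariant_separation x'm nx'.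
(* [D] lowers the degree by [m], so it vanishes on the [p i] of lower degree
   and it is constant on those of degree [m] *)
have /choice[e eE] : forall i, exists e : K,
    (forall z, regular_point z -> D (p i) z = e) /\ (k i != m -> e = 0).
  move=> i; have [g + gE] := Dk _ _ (pk i).
  have [/eqP kim|kim] := boolP (k i == m).
    rewrite kim leqnn subnn => -[e ge]; exists e; split=> // z zr.
    by rewrite gE // ge.
  rewrite leqNgt ltn_neqAle kim km /= => g0; exists 0; split=> // z zr.
  by rewrite gE // g0.
pose Tn f z := D f z + \sum_(i | k i == m) - e i * T i f z.
have Tn_good : admissible m Tn.
  by apply: (@admissible_sum m D _ _ _ (fun i => - e i) T) => // i /eqP <-.
have Tx' i z : regular_point z -> k i == m -> T i x' z = 0.
  move=> zr kim; have [Til _ _] := Tk i.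
  rewrite (Til z zr 1 x (fun z => \sum_(j | k j == m) - c j * p j z) x'); last first.
    by move=> rho _; rewrite mul1r.
  rewrite mul1r (cE i kim z zr).
  rewrite (orbit_linear_sum (r := index_enum 'I_d)
    (a := fun j => if k j == m then - c j else 0) (F := p) Til zr); last first.
    move=> rho _; rewrite big_mkcond /=; apply: eq_bigr => j _.
    by case: ifP => _ //; rewrite mul0r.
  rewrite (bigD1 i) //= kim Tp // eqxx mulr1 big1 ?addr0 ?subrr // => j ji.
  by rewrite Tp // [i == j]eq_sym (negPf ji) mulr0.
have Tn_x' z : regular_point z -> Tn x' z = 1.
  move=> zr; rewrite /Tn Dx' // big1 ?addr0 // => i kim.
  by rewrite Tx' // mulr0.
have Tn_p j z : regular_point z -> Tn (p j) z = 0.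
  move=> zr; have [De ez] := eE j; rewrite /Tn De //.
  have [kjm|kjm] := boolP (k j == m).
    rewrite (bigD1 j) //= Tp // eqxx mulr1 big1 ?addr0 ?subrr // => i /andP[_ ij].
    by rewrite Tp // (negPf ij) mulr0.
  rewrite ez // add0r big1 // => i kim; rewrite Tp //.
  by rewrite (_ : i == j = false) ?mulr0 //; apply: contraNF kjm => /eqP<-.
have /choice[q qE] : forall i, exists q, form (m - k i) q /\
    forall z, regular_point z -> T i x' z = q z.
  move=> i; have [_ Tl _] := Tk i; have [g + gE] := Tl m x' x'm.
  by rewrite km => gm; exists g.
pose Ti i f z := T i f z + (-1 * q i z) * Tn f z.
have Ti_good i : admissible (k i) (Ti i).
  have [qm _] := qE i; apply: (admissible_comb (Tk i) (formZ (-1) qm)).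
  by rewrite subnK.
(* the new form gets the index [ord0] *)
exists d.+1, (fun i => oapp k m (unlift ord0 i)),
  (fun i => oapp p x' (unlift ord0 i)), (fun i => oapp Ti Tn (unlift ord0 i)).
split.
- split.
  + by move=> i; case: (unliftP ord0 i) => [j|] _ /=.
  + by move=> i; case: (unliftP ord0 i) => [j|] _ /=.
  + move=> i j z zr.
    case: (unliftP ord0 i) => [i'|] ->; case: (unliftP ord0 j) => [j'|] -> /=.
    * by rewrite /Ti Tn_p // mulr0 addr0 Tp // (inj_eq lift_inj).
    * have [_ qz] := qE i'; by rewrite /Ti Tn_x' // qz // mulr1 mulN1r subrr.
    * by rewrite Tn_p.
    * by rewrite Tn_x'.
- by move=> i; case: (unliftP ord0 i) => [j|] _ /=.
- move=> i; have := generated_basis (fun i => oapp p x' (unlift ord0 i)) (lift ord0 i).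
  by rewrite liftK.
- set p' := fun i : 'I_d.+1 => _; rewrite x'E.
  have [_ Pc] := generated_closed p'; apply: Pc.
    by have := generated_basis p' ord0; rewrite /p' unlift_none.
  exists (fun i _ => oapp (fun i => if k i == m then c i else 0) 0 (unlift ord0 i)) => //.
  move=> z; rewrite big_ord_recl /p' unlift_none /= mul0r add0r.
  by apply: eq_bigr => i _; rewrite liftK.
Qed.


Lemma dual_system_extend_seq (I : eqType) (t : seq I) (F : I -> V -> K) d
    (k : 'I_d -> nat) (p : 'I_d -> V -> K) (T : 'I_d -> (V -> K) -> V -> K) m :
    dual_system k p T -> (forall i, k i <= m)%N ->
    (forall j g, (j < m)%N -> form j g -> generated p g) ->
    (forall i, form m (F i)) ->
  exists d' (k' : 'I_d' -> nat) (p' : 'I_d' -> V -> K)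
    (T' : 'I_d' -> (V -> K) -> V -> K), [/\ dual_system k' p' T',
    forall i, (k' i <= m)%N, forall i, generated p' (p i) &
    {in t, forall i, generated p' (F i)}].
Proof.
move=> Tp km pm Fm; elim: t => [|x t [d' [k' [p' [T' [Tp' km' pp' tp']]]]]].
  by exists d, k, p, T; split=> // i; exact: generated_basis.
have pm' j g : (j < m)%N -> form j g -> generated p' g.
  by move=> jm jg; apply: generated_trans pp' _; exact: pm jg.
have [d2 [k2 [p2 [T2 [Tp2 km2 pp2 xp2]]]]] := dual_system_extend Tp' km' pm' (Fm x).
exists d2, k2, p2, T2; split=> // i.
  exact: generated_trans pp2 (pp' i).
by rewrite in_cons => /predU1P[->//|it]; apply: generated_trans pp2 _; exact: tp'.
Qed.

Lemma dual_system_degree m : exists d (k : 'I_d -> nat) (p : 'I_d -> V -> K)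
    (T : 'I_d -> (V -> K) -> V -> K), [/\ dual_system k p T,
  forall i, (k i <= m)%N & forall j g, (j < m)%N -> form j g -> generated p g].
Proof.
elim: m => [|m [d [k [p [T [Tp km pm]]]]]].
  exists 0%N, (fun=> 0%N), (fun _ _ => 0), (fun _ _ _ => 0).
  by split=> //; split; case.
pose F (a : {ffun 'I_n -> 'I_m.+1}) : V -> K :=
  if (\sum_j a j)%N == m then monomial (fun j => a j : nat) else (fun=> 0).
have Fm a : form m (F a).
  rewrite /F; case: eqP => [am|_]; last exact: form0.
  by have := monomial_form (fun j => a j : nat); rewrite am.
have [d' [k' [p' [T' [Tp' km' pp' Fp]]]]] :=
  dual_system_extend_seq (index_enum {ffun 'I_n -> 'I_m.+1}) Tp km pm Fm.
exists d', k', p', T'; split=> //; first by move=> i; exact: leq_trans (km' i) _.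
move=> j g; rewrite ltnS leq_eqVlt => /predU1P[->|jm] jg; last first.
  by apply: generated_trans pp' _; exact: pm jg.
apply: monomial_span jg; first exact: generated_closed.
move=> a am; have alt i : (a i < m.+1)%N.
  by rewrite ltnS -am (bigD1 i) //= leq_addr.
have := Fp [ffun i => Ordinal (alt i)] (mem_index_enum _).
rewrite /F (eq_bigr a) => [|i _]; last by rewrite ffunE.
rewrite am eqxx; suff -> : (fun j => [ffun i => Ordinal (alt i)] j : nat) = a by [].
by apply/funext => i; rewrite ffunE.
Qed.

(** Beyond the degree [m], forms are in the ideal, hence generated by forms of
    lower degree. *)
Lemma generating_dual_system : exists d (k : 'I_d -> nat) (p : 'I_d -> V -> K)
    (T : 'I_d -> (V -> K) -> V -> K),
  dual_system k p T /\ forall j g, form j g -> generated p g.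
Proof.
pose m := (n * (size gs).-1).+1.
have [d [k [p [T [Tp _ pm]]]]] := dual_system_degree m.
exists d, k, p, T; split=> // j; have [b] := ubnP j.
elim: b j => // b IH j; rewrite ltnS => jb g jg.
have [jm|mj] := ltnP j m; first exact: pm jg.
apply: (@hilbert_ideal_generated _ _ j); last exact: (hilbert_ideal_large lG gs_uniq gsP).
by move=> i h ij; apply: IH; exact: leq_trans ij jb.
Qed.

Inductive polynomial : (V -> K) -> Prop :=
| polynomial0 : polynomial (fun=> 0)
| polynomialA m f g : form m f -> polynomial g -> polynomial (fun z => f z + g z).

Lemma polynomial_closed : closed_comb polynomial.
Proof.
split=> [|c f g]; first exact: polynomial0.
elim=> [|m f' f2 mf _ IH] Pg.
  by have -> : (fun z => c * 0 + g z) = g by apply/funext => z; rewrite mulr0 add0r.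
have -> : (fun z => c * (f' z + f2 z) + g z) = (fun z => c * f' z + (c * f2 z + g z)).
  by apply/funext => z; ring.
by apply: (@polynomialA m); [exact: formZ|exact: IH].
Qed.

Lemma polynomial_generated d (p : 'I_d -> V -> K) f :
  (forall j g, form j g -> generated p g) -> polynomial f -> generated p f.
Proof.
move=> pgen; have [p0 pc] := generated_closed p.
elim=> // m f' f2 mf _ IH.
have -> : (fun z => f' z + f2 z) = (fun z => 1 * f' z + f2 z).
  by apply/funext => z; rewrite mul1r.
by apply: pc => //; exact: pgen mf.
Qed.

Lemma polynomial_coordM j f : polynomial f -> polynomial (fun z => z j 0 * f z).
Proof.
elim=> [|m f' f2 mf _ IH].
  have -> : (fun z : V => z j 0 * 0) = (fun=> 0 : K) by apply/funext => z; rewrite mulr0.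
  exact: polynomial0.
have -> : (fun z : V => z j 0 * (f' z + f2 z)) = (fun z => z j 0 * f' z + z j 0 * f2 z).
  by apply/funext => z; ring.
by apply: (@polynomialA m.+1); [exact: (formM (form_coord j) mf)|exact: IH].
Qed.

(** For each [y] in the list, a factor of degree one that vanishes at [y] and
    takes the value [1] at [x]. *)
Lemma polynomial_separation (t : seq V) (x : V) :
  exists2 P, polynomial P & P x = 1 /\ {in t, forall y, y != x -> P y = 0}.
Proof.
have [_ Pc] := polynomial_closed.
elim: t => [|y t [P Pp [Px Pt]]].
  exists (fun z => 1 + 0); last by rewrite addr0.
  by apply: (@polynomialA 0) => //; [exists 1|exact: polynomial0].
have [->|yx] := eqVneq y x.
  exists P => //; split=> // z; rewrite in_cons => /predU1P[->|zt]; last exact: Pt.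
  by rewrite eqxx.
have [j yj] : exists j, y j 0 != x j 0.
  apply: contrapT => nj; case/eqP: yx; apply/matrixP => i k; rewrite ord1.
  by apply: contrapT => /eqP yi; apply: nj; exists i.
have xy0 : x j 0 - y j 0 != 0 by rewrite subr_eq0 eq_sym.
pose c := (x j 0 - y j 0)^-1.
exists (fun z : V => c * (z j 0 * P z) + (- (c * y j 0) * P z + 0)).
  apply: (Pc); first exact: polynomial_coordM.
  by apply: (Pc) => //; exact: polynomial0.
split; first by rewrite Px addr0 !mulr1 -mulrBr mulVf.
move=> z; rewrite in_cons => /predU1P[-> _|zt zx]; first by ring.
by rewrite Pt // !mulr0 addr0 addr0.
Qed.

Lemma orbit_interpolation z (y : 'M[K]_n -> K) : regular_point z ->
  exists2 P, polynomial P & {in gs, forall rho, P (rho *m z) = y rho}.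
Proof.
have [Gu G1 GM GV] := lG; move=> zr.
have /choice[L LP] : forall rho, exists P, polynomial P /\
    (P (rho *m z) = 1 /\ {in [seq sigma *m z | sigma <- gs], forall u,
      u != rho *m z -> P u = 0}).
  move=> rho.
  have [P Pp Pz] := polynomial_separation [seq sigma *m z | sigma <- gs] (rho *m z).
  by exists P.
exists (fun u => \sum_(rho <- gs) y rho * L rho u).
  apply: (closed_comb_sum (F := fun rho u => y rho * L rho u) polynomial_closed).
  move=> rho _; have [_ Pc] := polynomial_closed.
  have -> : (fun u => y rho * L rho u) = (fun u => y rho * L rho u + 0).
    by apply/funext => u; rewrite addr0.
  by apply: Pc; [have [] := LP rho|exact: polynomial0].
move=> rho rgs; rewrite (bigD1_seq rho) //=.
have [_ [-> _]] := LP rho; rewrite mulr1 big1_seq ?addr0 // => sigma /andP[sr sgs].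
have [_ [_ ->]] := LP sigma; rewrite ?mulr0 //.
  by apply/mapP; exists rho.
apply: contra_neq sr => E; have [/gsP Gr /gsP Gs] := (rgs, sgs).
have /(congr1 (mulmx (invmx rho))) := E.
rewrite !mulmxA mulVmx ?Gu // mul1mx => /esym /zr.
move=> /(_ (GM _ _ (GV _ Gr) Gs)) /(congr1 (mulmx rho)).
by rewrite mulmxA mulmxV ?Gu // mul1mx mulmx1.
Qed.

Hypothesis A_act : forall rho f, G rho -> A f -> A (fun z => f (rho *m z)).
Hypothesis A_density : forall f g, A f -> A g ->
  (forall z, Omega z -> regular_point z -> f z = g z) ->
  forall z, Omega z -> f z = g z.
Hypothesis regular_exists : exists z0, regular_point z0.

Definition invariant_on f :=
  forall rho z, G rho -> Omega z -> f (rho *m z) = f z.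

(** The matrix of the values of the [p i] on a regular orbit has independent
    rows, because of the [T i], and its rows span, by interpolation. *)
Lemma dual_system_card d (k : 'I_d -> nat) (p : 'I_d -> V -> K)
    (T : 'I_d -> (V -> K) -> V -> K) :
  dual_system k p T -> (forall j g, form j g -> generated p g) -> d = size gs.
Proof.
move=> [pk Tk Tp] pgen; have [z0 z0r] := regular_exists.
have [Gu G1 GM GV] := lG.
pose M : 'M[K]_(d, size gs) := \matrix_(i, j) p i (nth 1%:M gs j *m z0).
have pgenP f := polynomial_generated (f := f) pgen.
have Mfree : row_free M.
  apply: inj_row_free => c cM; apply/rowP => j; rewrite [RHS]mxE.
  have [Tl _ _] := Tk j.
  have := orbit_linear_sum (r := index_enum 'I_d) (a := fun i => c 0 i) (F := p)
    (h := fun=> 0) Tl z0r.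
  rewrite (orbit_linear0 Tl z0r) // (bigD1 j) //= Tp // eqxx mulr1 big1 ?addr0.
    move=> <- // rho /gsP rgs; have /rowP := cM.
    have ilt : (index rho gs < size gs)%N by rewrite index_mem.
    move=> /(_ (Ordinal ilt)); rewrite [RHS]mxE [LHS]mxE => E; rewrite -[LHS]E.
    by apply: eq_bigr => i _; rewrite mxE /= nth_index.
  by move=> i ij; rewrite Tp // eq_sym (negPf ij) mulr0.
have Mfull : row_full M.
  rewrite -sub1mx; apply/row_subP => i.
  have [P /pgenP[r ri rE] PE] :=
    orbit_interpolation (fun rho => (rho == nth 1%:M gs i)%:R) z0r.
  have -> : row i (1%:M : 'M[K]_(size gs)) = (\row_j r j z0) *m M.
    apply/rowP => j; rewrite !mxE.
    have jgs : nth 1%:M gs j \in gs by rewrite mem_nth.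
    have := PE _ jgs; rewrite rE nth_uniq // eq_sym => E.
    rewrite -[LHS]E; apply: eq_bigr => l _; rewrite !mxE ri //.
    exact/gsP.
  exact: submxMl.
by move/eqP: Mfree => <-; move/eqP: Mfull.
Qed.

Theorem free_over_invariants : exists p : 'I_(size gs) -> V -> K,
  [/\ forall i, A (p i),
    forall f, A f -> exists2 a : 'I_(size gs) -> V -> K,
      (forall i, A (a i) /\ invariant_on (a i)) &
      (forall z, Omega z -> f z = \sum_i a i z * p i z) &
    forall a : 'I_(size gs) -> V -> K,
      (forall i, A (a i) /\ invariant_on (a i)) ->
      (forall z, Omega z -> \sum_i a i z * p i z = 0) ->
      forall i z, Omega z -> a i z = 0].
Proof.
have [d [k [p [T [Tp pgen]]]]] := generating_dual_system.
have dE := dual_system_card Tp pgen; case: _ / dE.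
have [pk Tk Tpp] := Tp.
have pgenP f := polynomial_generated (f := f) pgen.
have Ap i : A (p i) by exact: A_form (pk i).
have A0 : A (fun=> 0) by apply: (@A_form 0); exists 0.
have Asum (a : 'I_d -> V -> K) : (forall i, A (a i)) -> A (fun z => \sum_i a i z * p i z).
  move=> Aa; elim: (index_enum 'I_d) => [|i r IH].
    have -> : (fun z => \sum_(i <- [::]) a i z * p i z) = (fun=> 0).
      by apply/funext => z; rewrite big_nil.
    exact: A0.
  have -> : (fun z => \sum_(i <- i :: r) a i z * p i z) =
    (fun z => a i z * p i z + \sum_(i <- r) a i z * p i z).
    by apply/funext => z; rewrite big_cons.
  by apply: A_add => //; apply: A_mul.
exists p; split=> //.
- move=> f Af.
  have /choice[a aP] : forall i, exists a, A a /\ (forall z, Omega z ->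
      regular_point z -> T i f z = a z).
    by move=> i; have [_ _ TA] := Tk i; have [a Aa aE] := TA f Af; exists a.
  have key z : Omega z -> regular_point z -> exists r : 'I_d -> V -> K,
      [/\ forall i, invariant G (r i), forall i rho, G rho -> a i (rho *m z) = r i z
      & f z = \sum_i r i z * p i z].
    move=> Oz zr; have [P /pgenP[r ri rE] PE] :=
      orbit_interpolation (fun rho => f (rho *m z)) zr.
    have [Gu G1 GM GV] := lG.
    exists r; split=> //; last first.
      by have := PE 1%:M ((gsP _).2 G1); rewrite mul1mx rE.
    move=> i rho Gr; have [_ <-] := aP i; first last.
    + exact: regular_act.
    + exact: Omega_act.
    have [Tl _ _] := Tk i.
    rewrite (orbit_linear_sum (r := index_enum 'I_d) (a := fun j => r j z) (F := p) Tl
      (regular_act Gr zr)); last first.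
      move=> sigma Gs; rewrite mulmxA -PE; last by apply/gsP; exact: GM.
      by rewrite rE; apply: eq_bigr => j _; rewrite ri //; exact: GM.
    rewrite (bigD1 i) //= Tpp; last exact: regular_act.
    rewrite eqxx mulr1 big1 ?addr0 // => j ji.
    by rewrite Tpp ?[i == j]eq_sym ?(negPf ji) ?mulr0 //; exact: regular_act.
  exists a.
    move=> i; have [Aai _] := aP i; split=> // rho z Gr Oz.
    apply: (A_density (A_act Gr Aai) Aai _ Oz) => {Oz}z Oz zr.
    have [r [_ ar _]] := key z Oz zr; have [_ G1 _ _] := lG.
    by rewrite (ar i rho Gr) -(ar i 1%:M G1) mul1mx.
  apply: A_density => //; first by apply: Asum => i; have [] := aP i.
  move=> z Oz zr; have [r [ri ar ->]] := key z Oz zr; have [_ G1 _ _] := lG.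
  by apply: eq_bigr => i _; rewrite -(ar i 1%:M G1) mul1mx.
- move=> a aP a0 i z Oz; have [Aai _] := aP i.
  apply: (A_density Aai A0 _ Oz) => {Oz}z Oz zr; have [Tl _ _] := Tk i.
  have [_ G1 _ _] := lG.
  have := orbit_linear_sum (r := index_enum 'I_d) (a := fun j => a j z) (F := p)
    (h := fun=> 0) Tl zr.
  rewrite (orbit_linear0 Tl zr) // (bigD1 i) //= Tpp // eqxx mulr1 big1 ?addr0.
    move=> <- // rho Gr; rewrite -[LHS](a0 (rho *m z)); last exact: Omega_act.
    by apply: eq_bigr => j _; have [_ ->] := aP j.
  by move=> j ji; rewrite Tpp // [i == j]eq_sym (negPf ji) mulr0.
Qed.

End Operators.

(** * Density of the regular points *)

Section Avoidance.
Context {K : numFieldType} {m n : nat}.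
Implicit Types (As : seq 'M[K]_(m, n)) (z u : 'cV[K]_n).

(** For each matrix [M] in [As], at most one [t] satisfies
    [M *m (z + t *: u) = 0]. *)
Lemma avoid_on_line As z u : {in As, forall M, M *m u != 0} ->
  exists ts : seq K, forall t, t \notin ts ->
    {in As, forall M, M *m (z + t *: u) != 0}.
Proof.
elim: As => [|M As IH] Mu; first by exists [::].
have [|ts tsP] := IH; first by move=> M' M'As; apply: Mu; rewrite in_cons M'As orbT.
have /eqP Mu0 := Mu M (mem_head _ _).
have [i Mi] : exists i, (M *m u) i 0 != 0.
  apply: contrapT => no; apply: Mu0; apply/matrixP => i j; rewrite ord1 [RHS]mxE.
  by apply: contrapT => /eqP Mi; apply: no; exists i.
exists (- (M *m z) i 0 / (M *m u) i 0 :: ts) => t.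
rewrite in_cons negb_or => /andP[t0 /tsP tts] M'; rewrite in_cons.
move=> /predU1P[->|/tts //]; apply: contra_neq t0 => /matrixP/(_ i 0).
have -> : (M *m (z + t *: u)) i 0 = (M *m z) i 0 + t * (M *m u) i 0.
  by rewrite mulmxDr -scalemxAr mxE; congr (_ + _); rewrite mxE.
rewrite [RHS]mxE => /eqP; rewrite addrC addr_eq0 => /eqP <-.
by rewrite mulfK.
Qed.

Lemma pigeonhole_notin (F : nat -> K) (ts : seq K) : injective F ->
  exists i, F i \notin ts.
Proof.
move=> Finj; apply: contrapT => no.
have sub : {subset [seq F i | i <- iota 0 (size ts).+1] <= ts}.
  by move=> _ /mapP[i _ ->]; apply: contrapT => /negP Fi; apply: no; exists i.
have := uniq_leq_size _ sub; rewrite size_map size_iota ltnn => H.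
by apply/notF/H; rewrite map_inj_uniq ?iota_uniq.
Qed.

Lemma avoid_kernels As : 0 \notin As ->
  exists u, {in As, forall M, M *m u != 0}.
Proof.
elim: As => [|M As IH]; first by exists 0.
rewrite in_cons negb_or eq_sym => /andP[M0 /IH[u uP]].
have [w Mw] : exists w : 'cV[K]_n, M *m w != 0.
  apply: contrapT => no; case/eqP: M0; apply/matrixP => i j.
  have : M *m delta_mx j 0 = 0 :> 'cV_m.
    by apply: contrapT => /eqP h; apply: no; exists (delta_mx j 0).
  by rewrite -colE => /matrixP/(_ i 0); rewrite !mxE.
have [Mu|Mu] := eqVneq (M *m u) 0; last first.
  exists u => M'; rewrite in_cons => /predU1P[->//|]; exact: uP.
have [ts tsP] := avoid_on_line w uP.
have [i it] := pigeonhole_notin ts (@mulrIn K 1 (oner_neq0 _)).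
exists (w + i%:R *: u) => M'; rewrite in_cons => /predU1P[->|]; last exact: tsP.
by rewrite mulmxDr -scalemxAr Mu scaler0 addr0.
Qed.

End Avoidance.

Section Instance.
Context {R : realType} {n : nat}.
Local Notation C := (Num.NumField.sort (complex_complex__canonical__Num_NumField R)).
Local Notation V := 'cV[C]_n.
Variables (Omega : set V).
Hypothesis oO : open Omega.
Implicit Types (f g : V -> C).

Definition holo_on f := forall z, Omega z -> differentiable f z.

Lemma holo_onD f g : holo_on f -> holo_on g -> holo_on (fun z => f z + g z).
Proof.
by move=> hf hg z Oz; apply: (@differentiableD _ _ _ f g); [exact: hf|exact: hg].
Qed.

Lemma holo_onM f g : holo_on f -> holo_on g -> holo_on (fun z => f z * g z).
Proof.
by move=> hf hg z Oz; apply: (@differentiableM _ _ f g); [exact: hf|exact: hg].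
Qed.

Lemma form_holo k f : form k f -> holo_on f.
Proof.
elim: k f => [|k IH] f /=.
  by move=> [c ->] z _; exact: differentiable_cst.
move=> [g gP ->] z Oz.
have -> : (fun z : V => \sum_j z j 0 * g j z) = \sum_j (fun z : V => z j 0 * g j z).
  by apply/funext => w; rewrite fct_sumE.
apply: differentiable_sum => j.
apply: (@differentiableM _ _ (fun z : V => z j 0) (g j)); first exact: differentiable_coord.
exact: IH (gP j) z Oz.
Qed.

Lemma mulmx_differentiable (rho : 'M[C]_n) (z : V) :
  differentiable (fun z : V => rho *m z) z.
Proof.
have -> : (fun z : V => rho *m z) =
    \sum_(j < n) (fun z : V => z j 0 *: (rho *m delta_mx j 0)).
  apply/funext => w; rewrite fct_sumE [in LHS](matrix_sum_delta w) mulmx_sumr.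
  by apply: eq_bigr => j _; rewrite big_ord1 -scalemxAr.
apply: differentiable_sum => j.
by apply: (@differentiableZl _ _ _ (fun z : V => z j 0)); exact: differentiable_coord.
Qed.

Lemma holo_act (rho : 'M[C]_n) f : (forall z, Omega z -> Omega (rho *m z)) ->
  holo_on f -> holo_on (fun z => f (rho *m z)).
Proof.
move=> Or hf z Oz.
apply: (@differentiable_comp _ _ _ _ (fun z : V => rho *m z) f); last exact/hf/Or.
exact: mulmx_differentiable.
Qed.

Lemma holo_divided (s : 'M[C]_n) (v : V) (l : 'rV[C]_n) f :
    (forall z, Omega z -> Omega (s *m z)) -> 1%:M - s = v *m l -> l != 0 ->
    holo_on f ->
  exists2 g, holo_on g &
    forall z, Omega z -> f z - f (s *m z) = (l *m z) 0 0 * g z.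
Proof.
move=> Os sE l0 hf.
pose ell (z : V) : C := (l *m z) 0 0.
have ell_linear : linear ell.
  by move=> a u w; rewrite /ell mulmxDr -scalemxAr mxE; congr (_ + _); rewrite mxE.
pose L : {linear V -> C} := HB.pack ell (GRing.isLinear.Build _ _ _ _ ell ell_linear).
have [j lj] : exists j, l 0 j != 0.
  apply: contrapT => no; case/eqP: l0; apply/rowP => j; rewrite mxE.
  by apply: contrapT => /eqP h; apply: no; exists j.
pose v0 : V := (l 0 j)^-1 *: delta_mx j 0.
have Lv0 : L v0 = 1.
  by rewrite /= /ell /v0 -scalemxAr -colE mxE [X in _ * X]mxE mulVf.
have hB : holo_on (fun z => f z - f (s *m z)).
  by move=> z Oz; apply: (@differentiableB _ _ _ f); [exact: hf|exact: (holo_act Os hf)].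
have [|h hh hE] := holomorphic_division oO Lv0 hB; last by exists h.
move=> z Oz /= lz; have -> : s *m z = z; last by rewrite subrr.
apply/eqP; rewrite eq_sym -subr_eq0 -[X in X - _]mul1mx -mulmxBl sE -mulmxA.
rewrite (_ : l *m z = 0) ?mulmx0 //; apply/matrixP => i k.
by rewrite !ord1 [RHS]mxE.
Qed.

(** Along a line of direction [u] not in the kernels, [z] is a limit of points
    outside the kernels. *)
Lemma avoid_kernels_dense (As : seq 'M[C]_n) f g : 0 \notin As ->
    holo_on f -> holo_on g ->
    (forall z, Omega z -> {in As, forall M, M *m z != 0} -> f z = g z) ->
  forall z, Omega z -> f z = g z.
Proof.
move=> As0 hf hg fg z Oz; have [u uP] := avoid_kernels As0.
have [ts tsP] := avoid_on_line z uP.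
apply/eqP; rewrite -subr_eq0; apply/negP => /negP nz.
pose h z := f z - g z.
have ch : {for z, continuous h}.
  apply: differentiable_continuous.
  by apply: (@differentiableB _ _ _ f g); [exact: hf|exact: hg].
have n0 : 0 < normc (h z).
  by rewrite lt_def normc_ge0 andbT; apply: contra_neq nz => /eq0_normc.
have /near_vnorm[d1 d10 H1] := (cvg_normc (nbhs_filter z) h (h z)).2 ch _ n0.
have /near_vnorm[d2 d20 H2] : nbhs z Omega by exact: open_nbhs_nbhs.
pose d := Num.min d1 d2 / (vnorm u + 1).
have u1 : 0 < vnorm u + 1 by rewrite ltr_wpDl ?vnorm_ge0.
have d0 : 0 < d by rewrite divr_gt0 // lt_min d10.
pose F (i : nat) : C := (d / i.+1%:R)%:C.
have Finj : injective F.
  move=> i k /complexI /(mulfI (lt0r_neq0 d0)) /invr_inj /eqP.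
  by rewrite eqr_nat => /eqP[].
have [i /tsP it] := pigeonhole_notin ts Finj.
have Fd : vnorm (z + F i *: u - z) < Num.min d1 d2.
  have Fi : normc (F i) = d / i.+1%:R by rewrite normcR ger0_norm // divr_ge0 // ltW.
  rewrite addrAC subrr add0r vnormZ Fi.
  apply: le_lt_trans (_ : d * vnorm u < _).
    by rewrite ler_wpM2r ?vnorm_ge0 // ler_pdivrMr // ler_peMr ?(ltW d0) // ler1n.
  by rewrite /d mulrAC ltr_pdivrMr // ltr_pM2l ?ltrDl // lt_min d10.
move: Fd; rewrite lt_min => /andP[/H1 h1 /H2 Oz'].
by move: h1; rewrite /h (fg _ Oz' it) subrr sub0r normcN ltxx.
Qed.

End Instance.

Section Transfer.
Context {K : numFieldType} {n : nat} (G : set 'M[K]_n) (Omega : set 'cV[K]_n).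
Local Notation V := 'cV[K]_n.

Definition mk_holo (f : V -> K) (hf : forall z, Omega z -> differentiable f z) :
    holo Omega :=
  Holo (asboolT (ex_intro2 _ (fun f' => sigL Omega f = sigL Omega f') f hf erefl)).

Lemma holo_sumE (I : Type) (r : seq I) (F : I -> holo_module G Omega) (z : Omega) :
  holo_val (\sum_(i <- r) F i : holo_module G Omega) z = \sum_(i <- r) holo_val (F i) z.
Proof.
elim: r => [|i r IH]; first by rewrite !big_nil.
by rewrite !big_cons -IH.
Qed.

End Transfer.

(** * Freeness over the invariant functions *)

Lemma linear_group_smallest (K : fieldType) n (S : set 'M[K]_n) :
  S `<=` pseudoreflection -> linear_group (smallest linear_group S).
Proof.
move=> Sp; split.
- move=> rho /(_ [set M | M \in unitmx]) /=; apply; split; last by move=> s /Sp[].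
  split=> [//||r1 r2 /= h1 h2|r1 /= h1]; rewrite /= ?unitmx1 ?unitmx_mul ?h1 ?h2 //.
  by rewrite unitmx_inv.
- by move=> H [[]].
- by move=> r1 r2 h1 h2 H HH; have [[_ _ HM _] _] := HH; apply: HM; [exact: h1|exact: h2].
- by move=> r1 h1 H HH; have [[_ _ _ HV] _] := HH; apply: HV; exact: h1.
Qed.

Local Open Scope fset_scope.
Local Open Scope complex_scope.
Local Open Scope ring_scope.

Theorem theorem3p12 (R : realType) (n : nat) (G : set 'M[R[i]]_n)
    (Omega : set 'cV[R[i]]_n) :
  finite_set G -> generated_by_pseudoreflections G ->
  domain Omega -> invariant_set G Omega ->
  @finite_free_of_rank (inv_holo G Omega) (holo_module G Omega)
    #|` fset_set G|.
Proof.
move=> Gfin [S S_pseudo GS] [oO _] GO.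
have lG : linear_group G by rewrite GS; exact: linear_group_smallest.
have [Gu G1 GM GV] := lG.
pose gs := enum_fset (fset_set G).
have gs_uniq : uniq gs by exact: fset_uniq.
have gsP rho : rho \in gs <-> G rho.
  have -> : (rho \in gs) = (rho \in fset_set G) by [].
  by rewrite in_fset_set // inE.
have SG : (S `<=` G)%classic by rewrite GS; exact: sub_gen_smallest.
have S_gen (H : set 'M[R[i]]_n) : linear_group H ->
    (S `<=` H -> G `<=` H)%classic.
  by move=> lH SH; rewrite GS; exact: smallest_sub.
have Oact rho z : G rho -> Omega z -> Omega (rho *m z).
  by move=> Gr Oz; rewrite -(GO rho Gr); exists z.
pose As := [seq rho - 1%:M | rho <- gs & rho != 1%:M].
have As0 : 0 \notin As.
  apply/mapP => -[rho]; rewrite mem_filter => /andP[r1 _] /esym/eqP.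
  by rewrite subr_eq0 (negPf r1).
have Areg z : {in As, forall M, M *m z != 0} -> regular_point G z.
  move=> Az rho /gsP Gr rz; apply: contrapT => /eqP r1.
  have /Az : rho - 1%:M \in As by apply: map_f; rewrite mem_filter r1.
  by rewrite mulmxBl mul1mx rz subrr eqxx.
have := @free_over_invariants _ n G S gs lG gs_uniq gsP SG S_pseudo S_gen Omega
  (holo_on Omega) Oact (@form_holo R n Omega) (@holo_onD R n Omega)
  (@holo_onM R n Omega).
case.
- move=> s v l f Gs sE l0 hf; apply: holo_divided sE l0 hf => //.
  by move=> z; exact: Oact.
- by move=> rho f Gr; apply: holo_act => z; exact: Oact.
- move=> f g hf hg fg; apply: (avoid_kernels_dense oO As0 hf hg) => z Oz /Areg.
  exact: fg.
- by have [u /Areg] := avoid_kernels As0; exists u.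
move=> p [hp gen ind].
exists (fun i => mk_holo (hp i)); split.
- move=> v; have /asboolP[g hg vg] := holo_valP v.
  have [a aP aE] := gen g hg.
  have ainv i : (mk_holo (aP i).1) \in @invariant_pred _ n G Omega.
    apply/asboolP => rho Gr z w wz /=; have [_ ai] := aP i.
    rewrite /sigL /= -(ai rho (set_val w) Gr (set_valP w)) wz.
    by rewrite mulmxA mulmxV ?Gu // mul1mx.
  exists (fun i => InvHolo (ainv i)).
  apply: val_inj; apply/funext => z; rewrite [RHS]holo_sumE.
  by rewrite [LHS](congr1 (@^~ z) vg) /sigL /= (aE _ (set_valP z)).
move=> a a0 i.
have /choice[b bP] : forall i, exists b, holo_on Omega b /\
    (a i : Omega -> R[i]) = sigL Omega b.
  by move=> j; have /asboolP[b hb bE] := holo_valP (a j); exists b.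
apply: val_inj; apply: val_inj; apply/funext => z.
have [hb bE] := bP i; rewrite [LHS](congr1 (@^~ z) bE).
apply: (ind b _ _ i (set_val z) (set_valP z)).
- move=> j; have [hbj bjE] := bP j; split=> // rho w Gr Ow.
  have /asboolP aj := inv_holo_valP (a j).
  have Orw := Oact _ _ Gr Ow.
  pose w1 : Omega := exist (fun w => w \in Omega) _ (mem_set Ow).
  pose w2 : Omega := exist (fun w => w \in Omega) _ (mem_set Orw).
  have := aj rho Gr w2 w1; rewrite bjE /sigL /= => -> //.
  by rewrite mulmxA mulVmx ?Gu // mul1mx.
- move=> w Ow; pose w1 : Omega := exist (fun w => w \in Omega) _ (mem_set Ow).
  have := congr1 (fun f : holo_module G Omega => holo_val f w1) a0.
  rewrite /= holo_sumE => E; rewrite -[RHS]E; apply: eq_bigr => j _.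
  by have [_ bjE] := bP j; rewrite [RHS](congr1 (fun f => f w1 * p j w) bjE).
Qed.
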